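(* There is an absolute constant $C>0$ such that the following holds. Let $m\ge 2$, let $A\in\mathbb{R}^{m\times n}$ have rank $m$, let $b\in\mathbb{R}^m$, and let $P=\{x\in\mathbb{R}^n : Ax=b,\ x\ge \mathbf{0}\}$. Then for every feasible point $x\in P$ and every vertex $v$ of $P$ there exists a circuit walk in $P$ from $x$ to $v$ of length at most $n+C\,m^2\log m$. Furthermore, such a circuit walk can be constructed in strongly polynomial time (given $A$, $b$, $x$ and $v$).
   Context: For a vector $z\in\mathbb{R}^n$, $\operatorname{supp}(z)=\{i: z_i\ne 0\}$. An elementary vector of $A$ is a nonzero vector $g\in\ker(A)$ of inclusion-minimal support, i.e. there is no $h\in\ker(A)\setminus\{\mathbf 0\}$ with $\operatorname{supp}(h)\subsetneq\operatorname{supp}(g)$. A circuit walk in $P$ of length $k$ from $x$ to $y$ is a sequence $x=x^{(0)},x^{(1)},\ldots,x^{(k)}=y$ of points of $P$ such that for each $i\in\{0,\dots,k-1\}$ one has $x^{(i+1)}=x^{(i)}+\alpha^{(i)}g^{(i)}$ for some elementary vector $g^{(i)}$ of $A$ and some real $\alpha^{(i)}>0$ that is chosen maximally, i.e. $x^{(i)}+\alpha' g^{(i)}\notin P$ for every $\alpha'>\alpha^{(i)}$. Strongly polynomial time means that the number of elementary arithmetic operations and comparisons is bounded by a polynomial in the dimensions $m,n$ only, independently of the numerical values of the input. *)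

(* Defs.v *)
From mathcomp Require Import all_boot all_order all_algebra.
From mathcomp Require Import reals exp.

Set Implicit Arguments.
Unset Strict Implicit.
Unset Printing Implicit Defensive.

Import Order.TTheory GRing.Theory Num.Theory.
Local Open Scope ring_scope.

Section Geometry.
Variable R : realFieldType.

Definition supp (n : nat) (z : 'cV[R]_n) : {set 'I_n} := [set i | z i 0 != 0].

Definition elementary_vector (m n : nat) (A : 'M[R]_(m, n)) (g : 'cV[R]_n) :
    Prop :=
  [/\ g != 0, A *m g = 0
    & ~ exists h : 'cV[R]_n, [/\ h != 0, A *m h = 0 & supp h \proper supp g]].

Definition in_polyhedron (m n : nat) (A : 'M[R]_(m, n)) (b : 'cV[R]_m)
    (x : 'cV[R]_n) : Prop :=
  A *m x = b /\ forall i, 0 <= x i 0.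

(* Vertices are extreme points: no proper convex combination of two points of
   the polyhedron is equal to v unless both points are v. *)
Definition vertex (m n : nat) (A : 'M[R]_(m, n)) (b : 'cV[R]_m)
    (v : 'cV[R]_n) : Prop :=
  in_polyhedron A b v /\
  forall (y z : 'cV[R]_n) (t : R),
    in_polyhedron A b y -> in_polyhedron A b z -> 0 < t < 1 ->
    v = t *: y + (1 - t) *: z -> y = v /\ z = v.

(* Only the values w 0, ..., w k of the sequence w are constrained. *)
Definition circuit_walk (m n : nat) (A : 'M[R]_(m, n)) (b : 'cV[R]_m)
    (x y : 'cV[R]_n) (k : nat) (w : nat -> 'cV[R]_n) : Prop :=
  [/\ w 0%N = x, w k = y,
      forall i : nat, (i <= k)%N -> in_polyhedron A b (w i)
    & forall i : nat, (i < k)%N -> exists (g : 'cV[R]_n) (alpha : R),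
        [/\ elementary_vector A g, 0 < alpha, w i.+1 = w i + alpha *: g
          & forall alpha' : R, alpha < alpha' ->
              ~ in_polyhedron A b (w i + alpha' *: g)]].

End Geometry.

(* Model of computation: a real random access machine, programmed in a small
   imperative language.  A program is one finite piece of syntax, used for all
   dimensions and all numerical data, and the only real constants in it are 0
   and 1.  The store has natural-number registers, for dimensions and indices,
   and real arrays with two indices.  Registers are only added, subtracted
   (truncated at 0) and compared: leaving out their multiplication keeps their
   bit length at most linear in the running time, so that unit cost is fair.
   Real operations are the exact field operations (x / 0 is 0) and comparison;
   there is no conversion of a real number to a natural number. *)

Inductive nexp : Type :=
| NConst of nat
| NReg of nat
| NAdd of nexp & nexp
| NSub of nexp & nexp.

Inductive rexp : Type :=
| RZero
| ROne
| RGet of nat & nexp & nexp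
| RAdd of rexp & rexp
| RSub of rexp & rexp
| RMul of rexp & rexp
| RDiv of rexp & rexp.

Inductive bexp : Type :=
| BNLe of nexp & nexp
| BRLe of rexp & rexp
| BNot of bexp
| BAnd of bexp & bexp.

Inductive prog : Type :=
| Skip
| NSet of nat & nexp
| RSet of nat & nexp & nexp & rexp
| Seq of prog & prog
| If of bexp & prog & prog
| While of bexp & prog.

Fixpoint ncost (e : nexp) : nat :=
  match e with
  | NConst _ | NReg _ => 1
  | NAdd e1 e2 | NSub e1 e2 => (ncost e1 + ncost e2).+1
  end.

Fixpoint rcost (e : rexp) : nat :=
  match e with
  | RZero | ROne => 1
  | RGet _ i j => (ncost i + ncost j).+1
  | RAdd e1 e2 | RSub e1 e2 | RMul e1 e2 | RDiv e1 e2 =>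
      (rcost e1 + rcost e2).+1
  end.

Fixpoint bcost (e : bexp) : nat :=
  match e with
  | BNLe e1 e2 => (ncost e1 + ncost e2).+1
  | BRLe e1 e2 => (rcost e1 + rcost e2).+1
  | BNot e1 => (bcost e1).+1
  | BAnd e1 e2 => (bcost e1 + bcost e2).+1
  end.

Section Semantics.
Variable R : realFieldType.

Record store : Type := Store {
  nreg : nat -> nat;
  rarr : nat -> nat -> nat -> R (* array name, first index, second index *)
}.

Fixpoint neval (s : store) (e : nexp) : nat :=
  match e with
  | NConst c => c
  | NReg r => nreg s r
  | NAdd e1 e2 => neval s e1 + neval s e2
  | NSub e1 e2 => neval s e1 - neval s e2
  end%N.

Fixpoint reval (s : store) (e : rexp) : R :=
  match e with
  | RZero => 0
  | ROne => 1
  | RGet a i j => rarr s a (neval s i) (neval s j)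
  | RAdd e1 e2 => reval s e1 + reval s e2
  | RSub e1 e2 => reval s e1 - reval s e2
  | RMul e1 e2 => reval s e1 * reval s e2
  | RDiv e1 e2 => reval s e1 / reval s e2
  end.

Fixpoint beval (s : store) (e : bexp) : bool :=
  match e with
  | BNLe e1 e2 => (neval s e1 <= neval s e2)%N
  | BRLe e1 e2 => reval s e1 <= reval s e2
  | BNot e1 => ~~ beval s e1
  | BAnd e1 e2 => beval s e1 && beval s e2
  end.

Definition nupd (s : store) (r c : nat) : store :=
  Store (fun r' => if r' == r then c else nreg s r') (rarr s).

Definition rupd (s : store) (a i j : nat) (c : R) : store :=
  Store (nreg s)
    (fun a' i' j' =>
       if [&& a' == a, i' == i & j' == j] then c else rarr s a' i' j').

(* exec p s t s' : started in s, the program p halts in s' after exactly t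
   operations. *)
Inductive exec : prog -> store -> nat -> store -> Prop :=
| exec_skip s : exec Skip s 1 s
| exec_nset s r e : exec (NSet r e) s (ncost e).+1 (nupd s r (neval s e))
| exec_rset s a i j e :
    exec (RSet a i j e) s (ncost i + ncost j + rcost e).+1
      (rupd s a (neval s i) (neval s j) (reval s e))
| exec_seq p1 p2 s1 s2 s3 t1 t2 :
    exec p1 s1 t1 s2 -> exec p2 s2 t2 s3 -> exec (Seq p1 p2) s1 (t1 + t2) s3
| exec_if_true c p1 p2 s s' t :
    beval s c -> exec p1 s t s' -> exec (If c p1 p2) s (bcost c + t).+1 s'
| exec_if_false c p1 p2 s s' t :
    ~~ beval s c -> exec p2 s t s' -> exec (If c p1 p2) s (bcost c + t).+1 s'
| exec_while_true c p s1 s2 s3 t1 t2 :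
    beval s1 c -> exec p s1 t1 s2 -> exec (While c p) s2 t2 s3 ->
    exec (While c p) s1 (bcost c + t1 + t2).+1 s3
| exec_while_false c p s :
    ~~ beval s c -> exec (While c p) s (bcost c).+1 s.

Lemma exec_deterministic p s t1 s1 t2 s2 :
  exec p s t1 s1 -> exec p s t2 s2 -> t1 = t2 /\ s1 = s2.
Proof.
move=> E; elim: E t2 s2 => {p s t1 s1}.
- by move=> s t2 s2 E; inversion E.
- by move=> s r e t2 s2 E; inversion E.
- by move=> s a i j e t2 s2 E; inversion E.
- move=> p1 p2 s1 s2 s3 t1 t2 _ IH1 _ IH2 t s E.
  inversion E as [| | |? ? ? ? ? ? ? E1 E2| | | |]; subst.
  by have [-> ?] := IH1 _ _ E1; subst; have [-> ->] := IH2 _ _ E2.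
- move=> c p1 p2 s s' t cT _ IH t2 s2 E.
  inversion E as [| | | |? ? ? ? ? ? _ E1|? ? ? ? ? ? cF _| |]; subst.
    by have [-> ->] := IH _ _ E1.
  by rewrite cT in cF.
- move=> c p1 p2 s s' t cF _ IH t2 s2 E.
  inversion E as [| | | |? ? ? ? ? ? cT _|? ? ? ? ? ? _ E1| |]; subst.
    by rewrite cT in cF.
  by have [-> ->] := IH _ _ E1.
- move=> c p s1 s2 s3 t1 t2 cT _ IH1 _ IH2 t s E.
  inversion E as [| | | | | |? ? ? ? ? ? ? _ E1 E2|? ? ? cF]; subst.
    by have [-> ?] := IH1 _ _ E1; subst; have [-> ->] := IH2 _ _ E2.
  by rewrite cT in cF.
- move=> c p s cF t2 s2 E.
  inversion E as [| | | | | |? ? ? ? ? ? ? cT _ _|]; subst=> //.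
  by rewrite cT in cF.
Qed.

Definition array_of_mx (m n : nat) (M : 'M[R]_(m, n)) (i j : nat) : R :=
  if (insub i, insub j) is (Some i', Some j') then M i' j' else 0.

(* Input: m and n in registers 0 and 1; A, b, x and v in arrays 0 to 3, a
   column vector being stored in column 0 of its array. *)
Definition input_store (m n : nat) (A : 'M[R]_(m, n)) (b : 'cV[R]_m)
    (x v : 'cV[R]_n) : store :=
  Store (fun r => nth 0%N [:: m; n] r)
    (fun a => match a with
              | 0%N => array_of_mx A
              | 1%N => array_of_mx b
              | 2%N => array_of_mx x
              | 3%N => array_of_mx v
              | _ => fun _ _ => 0
              end).

(* Output: the length of the walk in register 2, and its i-th point in row i of
   array 4. *)
Definition output_length (s : store) : nat := nreg s 2.

Definition output_walk (n : nat) (s : store) (i : nat) : 'cV[R]_n :=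
  \col_(j < n) rarr s 4 i j.

End Semantics.

(* Main.v *)
(* Write K = 2m and call coordinate i of x large if x_i > 2K v_i.  A feasible x
   with no large coordinate has its support inside that of v, hence equals v.

   First, steps along circuits supported in supp x make the columns of supp x
   independent; this takes at most n steps, and afterwards x has at most m large
   coordinates and v - x at most K nonzero entries.

   Then proceed in phases.  Fix the point x0 at the start of a phase and a large
   coordinate i.  A circuit conformal to v - x whose relative size at i is at
   least 1/K times its total relative size cannot be overshot by more than a
   factor 2K, so no coordinate becomes large, while x_i shrinks by a factor
   1 - 1/(2K).  After O(m log m) such steps some large coordinate has dropped
   below x0_i / K^6.  Now use a circuit conformal to (v - x0) + 4K (v - x)
   instead.  Along it, the coordinates that are not large hardly move before
   x_i reaches 0, and those that are close to 0 do not decrease; so the step is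
   blocked by a large coordinate, which becomes 0.  Hence there are at most m
   phases of O(m log m) steps.

   A circuit conformal to d with nonnegative product with a cost vector is
   obtained from d by adding multiples of kernel vectors of smaller support,
   which are columns of an orthogonal projector computed by rank-one updates. *)
Require Import Defs.
From mathcomp Require Import all_boot all_order all_algebra.
From mathcomp Require Import ring lra.
From mathcomp Require Import reals sequences exp.

Set Implicit Arguments.
Unset Strict Implicit.
Unset Printing Implicit Defensive.

Import Order.TTheory GRing.Theory Num.Theory.
Local Open Scope ring_scope.

(** * Program logic *)

Section ProgramLogic.
Variable R : realFieldType.
Implicit Types (s : store R) (p : prog) (Q : store R -> Prop).

Fixpoint wregs p : seq nat :=
  match p with
  | NSet r _ => [:: r]
  | Seq p1 p2 | If _ p1 p2 => wregs p1 ++ wregs p2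
  | While _ p1 => wregs p1
  | _ => [::]
  end.

Fixpoint warrs p : seq nat :=
  match p with
  | RSet a _ _ _ => [:: a]
  | Seq p1 p2 | If _ p1 p2 => warrs p1 ++ warrs p2
  | While _ p1 => warrs p1
  | _ => [::]
  end.

Definition frame (rs arrs : seq nat) s s' : Prop :=
  (forall r, r \notin rs -> nreg s' r = nreg s r) /\
  (forall a i j, a \notin arrs -> rarr s' a i j = rarr s a i j).

Lemma frame_refl rs arrs s : frame rs arrs s s. Proof. by []. Qed.

Lemma frame_trans rs arrs s1 s2 s3 :
  frame rs arrs s1 s2 -> frame rs arrs s2 s3 -> frame rs arrs s1 s3.
Proof.
by move=> [f1 g1] [f2 g2]; split=> *; [rewrite f2 ?f1|rewrite g2 ?g1].
Qed.

Lemma frame_sub rs arrs rs' arrs' s s' :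
  {subset rs <= rs'} -> {subset arrs <= arrs'} ->
  frame rs arrs s s' -> frame rs' arrs' s s'.
Proof.
move=> sr sa [f g]; split=> [r rN|a i j aN].
  by apply: f; apply: contra rN => /sr.
by apply: g; apply: contra aN => /sa.
Qed.

Lemma exec_frame p s t s' : exec p s t s' -> frame (wregs p) (warrs p) s s'.
Proof.
elim=> {p s t s'} //=.
- move=> s r e; split=> //= r'.
  by rewrite inE => /negPf ->.
- move=> s a i j e; split=> //= a' i' j'.
  by rewrite inE => /negPf ->.
- move=> p1 p2 s1 s2 s3 _ _ _ IH1 _ IH2.
  apply: (@frame_trans _ _ _ s2).
    by apply: frame_sub IH1 => x xI; rewrite mem_cat xI.
  by apply: frame_sub IH2 => x xI; rewrite mem_cat xI orbT.
- move=> c p1 p2 s s' _ _ _ IH.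
  by apply: frame_sub IH => x xI; rewrite mem_cat xI.
- move=> c p1 p2 s s' _ _ _ IH.
  by apply: frame_sub IH => x xI; rewrite mem_cat xI orbT.
- by move=> c p s1 s2 s3 _ _ _ _ IH1 _ IH2; apply: frame_trans IH1 IH2.
Qed.

(* Bounds the cost of a run in which every loop makes at most L turns; L is a
   number or a polynomial in m and n. *)
Fixpoint loop_cost (T : comNzSemiRingType) (L : T) p : T :=
  match p with
  | Skip => 1
  | NSet _ e => (ncost e).+1%:R
  | RSet _ i j e => (ncost i + ncost j + rcost e).+1%:R
  | Seq p1 p2 => loop_cost L p1 + loop_cost L p2
  | If c p1 p2 => loop_cost L p1 + loop_cost L p2 + (bcost c).+1%:R
  | While c p1 => (L + 1) * (loop_cost L p1 + (bcost c).+1%:R)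
  end.

(** [loop_cost] is built from semiring operations alone, so it commutes with evaluation: a
    polynomial bound on the turns of every loop yields a polynomial bound on the running time. *)
Lemma horner2_loop_cost (q : {poly {poly nat}}) p (x y : nat) :
  (loop_cost q p).[x%:P].[y] = loop_cost q.[x%:P].[y] p.
Proof.
elim: p => //=.
- by rewrite !hornerE.
- by move=> r e; rewrite -polyC_natr !hornerC -polyC_natr hornerC.
- by move=> a i j e; rewrite -polyC_natr !hornerC -polyC_natr hornerC.
- by move=> p1 <- p2 <-; rewrite !hornerD.
- move=> c p1 <- p2 <-; rewrite !hornerD -[in RHS]hornerD.
  by rewrite -polyC_natr !hornerC -polyC_natr hornerC -hornerD.
- move=> c p1 <-; rewrite hornerM !hornerD !hornerM !hornerD.
  by rewrite -polyC_natr !hornerC -polyC_natr hornerC.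
Qed.

Variable L : nat.

(** Total correctness together with the time bound, so that one derivation yields termination, cost
    and result. *)
Definition wp p Q s : Prop :=
  exists t s', [/\ exec p s t s', (t <= loop_cost (L : nat) p)%N & Q s'].

Lemma wp_conseq p Q Q' s :
  wp p Q s -> (forall s', frame (wregs p) (warrs p) s s' -> Q s' -> Q' s') ->
  wp p Q' s.
Proof.
move=> [t [s' [e le_t q]]] imp; exists t, s'; split=> //.
by apply: imp q; apply: exec_frame e.
Qed.

Lemma wp_skip Q s : Q s -> wp Skip Q s.
Proof. by move=> q; exists 1%N, s; split=> //; constructor. Qed.

Lemma wp_nset r e Q s : Q (nupd s r (neval s e)) -> wp (NSet r e) Q s.
Proof.
move=> q; do 2!eexists; split; [constructor| |exact: q].
by rewrite /= natn.
Qed.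

Lemma wp_rset a i j e Q s :
  Q (rupd s a (neval s i) (neval s j) (reval s e)) -> wp (RSet a i j e) Q s.
Proof.
move=> q; do 2!eexists; split; [constructor| |exact: q].
by rewrite /= natn.
Qed.

Lemma wp_seq p1 p2 Q s : wp p1 (wp p2 Q) s -> wp (Seq p1 p2) Q s.
Proof.
move=> [t1 [s1 [e1 le1 [t2 [s2 [e2 le2 q]]]]]].
exists (t1 + t2)%N, s2; split=> //; first exact: exec_seq e1 e2.
exact: leq_add.
Qed.

Lemma wp_if c p1 p2 Q s :
  (beval s c -> wp p1 Q s) -> (~~ beval s c -> wp p2 Q s) ->
  wp (If c p1 p2) Q s.
Proof.
case: (boolP (beval s c)) => cs H1 H2.
  have [t [s' [e le q]]] := H1 isT.
  exists (bcost c + t).+1, s'; split=> //; first exact: exec_if_true.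
  rewrite /= natn -addSn addnC leq_add2r.
  by apply: leq_trans le _; apply: leq_addr.
have [t [s' [e le q]]] := H2 isT.
exists (bcost c + t).+1, s'; split=> //; first exact: exec_if_false.
rewrite /= natn -addSn addnC leq_add2r.
by apply: leq_trans le _; apply: leq_addl.
Qed.

(** The index of [I] is fuel: it bounds the number of turns still to come, and a true test must find
    it positive. *)
Lemma wp_while (I : nat -> store R -> Prop) f c p s :
  (f <= L)%N -> I f s ->
  (forall f' s', frame (wregs p) (warrs p) s s' -> I f' s' -> beval s' c ->
     (0 < f')%N /\ wp p (I f'.-1) s') ->
  wp (While c p) (fun s' => ~~ beval s' c /\ exists f', I f' s') s.
Proof.
move=> fL If step.
suff terminates s1 : frame (wregs p) (warrs p) s s1 -> I f s1 ->
    exists t s', [/\ exec (While c p) s1 t s',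
      (t <= f.+1 * (loop_cost (L : nat) p + (bcost c).+1))%N &
      ~~ beval s' c /\ exists f', I f' s'].
  have [t [s' [e le q]]] := terminates s (frame_refl _ _ _) If.
  exists t, s'; split=> //; apply: leq_trans le _.
  rewrite /= natn; apply: leq_mul => //.
  by rewrite -addn1 leq_add2r.
elim: f s1 {If fL} => [|f IH] s1 fr If.
  have [c1|c1] := boolP (beval s1 c); first by have [] := step _ _ fr If c1.
  exists (bcost c).+1, s1; split; first exact: exec_while_false.
    by rewrite mul1n leq_addl.
  by split=> //; exists 0%N.
have [c1|c1] := boolP (beval s1 c); last first.
  exists (bcost c).+1, s1; split; first exact: exec_while_false.
    by rewrite mulSn -addnA addnCA leq_addr.
  by split=> //; exists f.+1.
have [_ [t1 [s2 [e1 le1 If2]]]] := step _ _ fr If c1.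
have [t2 [s3 [e2 le2 q]]] :=
  IH s2 (frame_trans fr (exec_frame e1)) If2.
exists (bcost c + t1 + t2).+1, s3; split=> //.
  exact: exec_while_true e1 e2.
rewrite mulSn -!addSn; apply: leq_add => //.
by rewrite addnC leq_add2r.
Qed.

Definition For r e p :=
  Seq (NSet r (NConst 0))
    (While (BNot (BNLe e (NReg r)))
       (Seq p (NSet r (NAdd (NReg r) (NConst 1))))).

Lemma wp_for (I : nat -> store R -> Prop) r e p N s :
  (N <= L)%N -> r \notin wregs p ->
  (forall s', frame (wregs (For r e p)) (warrs p) s s' -> neval s' e = N) ->
  I 0%N (nupd s r 0) ->
  (forall i s', (i < N)%N -> frame (wregs (For r e p)) (warrs p) s s' ->
     nreg s' r = i -> I i s' ->
     wp p (fun s'' => I i.+1 (nupd s'' r i.+1)) s') ->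
  wp (For r e p) (I N) s.
Proof.
move=> NL rp eN I0 step; apply: wp_seq; apply: wp_nset => /=.
set s0 := nupd s r 0.
have fr0 : frame (wregs (For r e p)) (warrs p) s s0.
  by split=> //= r'; rewrite inE negb_or => /andP[/negPf ->].
(* With [f] turns to go, the counter stands at [N - f]. *)
pose J f s' := [/\ (f <= N)%N, nreg s' r = (N - f)%N & I (N - f)%N s'].
apply: wp_conseq (wp_while (I := J) NL _ _) _.
- by rewrite /J subnn /= eqxx leqnn.
- move=> f s' fr [fN rs If] /= cs.
  have fr' : frame (wregs (For r e p)) (warrs p) s s'.
    apply: frame_trans fr0 _; apply: frame_sub fr => x /=.
      by rewrite !(mem_cat, inE) => /orP[] ->; rewrite ?orbT.
    by rewrite cats0.
  move: cs; rewrite rs (eN _ fr') -ltnNge => f0.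
  have {f0}: (0 < f)%N by case: (f) f0 => //; rewrite subn0 ltnn.
  case: f fN rs If => //= f fN rs If _; split=> //.
  apply: wp_seq.
  apply: wp_conseq (step _ _ _ fr' rs If) _.
    by rewrite -subSn ?subSS ?leq_subr.
  move=> s2 fr2 I2; apply: wp_nset => /=.
  rewrite (fr2.1 r) // rs addn1 -subSn // subSS in I2 *.
  by split=> //=; rewrite ?eqxx // ltnW.
- move=> s' fr [cs [f [fN rs If]]].
  have fr' : frame (wregs (For r e p)) (warrs p) s s'.
    apply: frame_trans fr0 _; apply: frame_sub fr => x /=.
      by rewrite !(mem_cat, inE) => /orP[] ->; rewrite ?orbT.
    by rewrite cats0.
  move: cs => /=; rewrite rs (eN _ fr') negbK => le'.
  have f0 : f = 0%N.
    move: le'; case: (f) fN => // k kN.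
    by rewrite leq_subRL // addSn ltnNge leq_addl.
  by move: If; rewrite f0 subn0.
Qed.

End ProgramLogic.

(** * Loops over arrays *)

Definition BTrue := BNLe (NConst 0) (NConst 0).

(* The loops below use registers 3 (rows or search index), 4 (columns) and 5
   (summation index). *)
Definition Map a e1 e2 c e e' :=
  For 3 e1 (For 4 e2
    (If c (RSet a (NReg 3) (NReg 4) e) (RSet a (NReg 3) (NReg 4) e'))).

Definition Acc a e1 e2 et e :=
  Seq (Map a e1 e2 BTrue RZero RZero)
    (For 5 et (Map a e1 e2 BTrue (RAdd (RGet a (NReg 3) (NReg 4)) e) RZero)).

Definition Find r c (v : nexp -> rexp) :=
  Seq (NSet r (NReg 1))
    (For 3 (NReg 1)
       (If (BAnd c (BNot (BAnd (BNot (BNLe (NReg 1) (NReg r)))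
                               (BRLe (v (NReg r)) (v (NReg 3))))))
         (NSet r (NReg 3)) Skip)).

Ltac list_subset :=
  let x := fresh in
  move=> x; rewrite /= ?mem_cat ?inE; repeat (case: (x == _) => //=).

Section Loops.
Variables (R : realFieldType) (L : nat).
Implicit Types (s : store R).

(** A cell is computed while it still holds its old value, so [e] may read the cell that it
    overwrites; this permits updates in place. *)
Lemma wp_map a e1 e2 c e e' n1 n2 (F : 'I_n1 -> 'I_n2 -> R) s :
  (n1 <= L)%N -> (n2 <= L)%N ->
  (forall s', frame [:: 3; 4]%N [:: a] s s' -> neval s' e1 = n1) ->
  (forall s', frame [:: 3; 4]%N [:: a] s s' -> neval s' e2 = n2) ->
  (forall (i : 'I_n1) (j : 'I_n2) s', frame [:: 3; 4]%N [:: a] s s' ->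
     nreg s' 3 = i -> nreg s' 4 = j -> rarr s' a i j = rarr s a i j ->
     (if beval s' c then reval s' e else reval s' e') = F i j) ->
  wp L (Map a e1 e2 c e e')
    (fun s' => forall (i : 'I_n1) (j : 'I_n2), rarr s' a i j = F i j) s.
Proof.
move=> n1L n2L e1N e2N cell.
pose I k s' := forall (i : 'I_n1) (j : 'I_n2),
  rarr s' a i j = if (i < k)%N then F i j else rarr s a i j.
apply: wp_conseq (wp_for (I := I) n1L _ _ _ _) _ => //.
- by move=> s' fr; apply: e1N; apply: frame_sub fr; list_subset.
- move=> i s' i1 fr s3 Ii.
  have {}fr : frame [:: 3; 4]%N [:: a] s s' by apply: frame_sub fr; list_subset.
  apply: wp_conseq.
    pose J l s'' := (forall (j : 'I_n2),
      rarr s'' a i j = if (j < l)%N then F (Ordinal i1) j else rarr s a i j) /\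
      (forall (k : 'I_n1) (j : 'I_n2), k != i :> nat ->
         rarr s'' a k j = rarr s' a k j).
    apply: (wp_for (I := J) n2L) => //.
    + move=> s'' fr'; apply: e2N; apply: frame_trans fr _.
      by apply: frame_sub fr'; list_subset.
    + split=> //= j.
      by have := Ii (Ordinal i1) j; rewrite /= ltnn.
    + move=> j s'' j1 fr' s4 [Jj Jk].
      have f3 : nreg s'' 3 = i by rewrite fr'.1.
      have cl : (if beval s'' c then reval s'' e else reval s'' e') =
                F (Ordinal i1) (Ordinal j1).
        apply: cell => //=.
          apply: frame_trans fr _.
          by apply: frame_sub fr'; list_subset.
        by have := Jj (Ordinal j1); rewrite /= ltnn.
      have post : J j.+1 (nupd (rupd s'' a i j (F (Ordinal i1) (Ordinal j1)))
                            4 j.+1).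
        split=> [j'|k j' ki] /=; rewrite !eqxx /=.
          rewrite Jj [in RHS]ltnS [in RHS]leq_eqVlt.
          have [jj|//] := eqVneq (j' : nat) j; rewrite /=.
          by rewrite (_ : Ordinal j1 = j') //; apply: val_inj.
        by rewrite (negPf ki) /= Jk.
      apply: wp_if => cs; apply: wp_rset; rewrite /= f3 s4.
        by move: cl; rewrite cs => ->.
      by move: cl; rewrite (negPf cs) => ->.
  move=> s'' _ [Jj Jk] i' j; rewrite /=.
  have [ii|ii] := eqVneq (i' : nat) i.
    have := Jj j; rewrite ltn_ord ii ltnS leqnn => ->.
    by rewrite (_ : Ordinal i1 = i') //; apply: val_inj.
  by rewrite Jk // Ii ltnS [in RHS]leq_eqVlt (negPf ii).
- by move=> s' _ I1 i j; rewrite I1 ltn_ord.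
Qed.

Lemma wp_acc a e1 e2 et e n1 n2 nt (F : 'I_nt -> 'I_n1 -> 'I_n2 -> R) s :
  (n1 <= L)%N -> (n2 <= L)%N -> (nt <= L)%N ->
  (forall s', frame [:: 3; 4; 5]%N [:: a] s s' -> neval s' e1 = n1) ->
  (forall s', frame [:: 3; 4; 5]%N [:: a] s s' -> neval s' e2 = n2) ->
  (forall s', frame [:: 3; 4; 5]%N [:: a] s s' -> neval s' et = nt) ->
  (forall (t : 'I_nt) (i : 'I_n1) (j : 'I_n2) s',
     frame [:: 3; 4; 5]%N [:: a] s s' ->
     nreg s' 3 = i -> nreg s' 4 = j -> nreg s' 5 = t ->
     reval s' e = F t i j) ->
  wp L (Acc a e1 e2 et e)
    (fun s' => forall (i : 'I_n1) (j : 'I_n2),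
       rarr s' a i j = \sum_t F t i j) s.
Proof.
move=> n1L n2L ntL e1N e2N etN cell.
have sub34 : {subset [:: 3; 4]%N <= [:: 3; 4; 5]%N}.
  by list_subset.
apply: wp_seq; apply: wp_conseq.
  apply: (wp_map (n1 := n1) (n2 := n2) (F := fun _ _ => 0)) => //.
    by move=> s' /(frame_sub sub34 (fun x => id)); apply: e1N.
  by move=> s' /(frame_sub sub34 (fun x => id)); apply: e2N.
move=> s0 fr0 zero.
have {}fr0 : frame [:: 3; 4; 5]%N [:: a] s s0.
  by apply: frame_sub fr0; list_subset.
pose I k s' := forall (i : 'I_n1) (j : 'I_n2),
  rarr s' a i j = \sum_(t < nt | (t < k)%N) F t i j.
have fr s' : frame (wregs (For 5 et (Map a e1 e2 BTrue
      (RAdd (RGet a (NReg 3) (NReg 4)) e) RZero))) (warrs (Map a e1 e2 BTrue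
      (RAdd (RGet a (NReg 3) (NReg 4)) e) RZero)) s0 s' ->
    frame [:: 3; 4; 5]%N [:: a] s s'.
  move=> fr; apply: frame_trans fr0 _; by apply: frame_sub fr; list_subset.
apply: wp_conseq (wp_for (I := I) ntL _ _ _ _) _ => //.
- by move=> s' /fr; apply: etN.
- by move=> i j; rewrite /= zero big1.
- move=> t s' tn /fr frs s5 It.
  have fr2 s2 : frame [:: 3; 4]%N [:: a] s' s2 ->
      frame [:: 3; 4; 5]%N [:: a] s s2.
    by move=> f2; apply: frame_trans frs _; apply: frame_sub f2.
  apply: wp_conseq.
    apply: (wp_map (n1 := n1) (n2 := n2)
      (F := fun i j => \sum_(t' < nt | (t' < t.+1)%N) F t' i j)) => //.
    + by move=> s2 /fr2; apply: e1N.
    + by move=> s2 /fr2; apply: e2N.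
    + move=> i j s2 f2 r3 r4 /=; rewrite r3 r4 => ->.
      rewrite (cell (Ordinal tn) i j _ (fr2 _ f2)) //; last by rewrite f2.1.
      rewrite It.
      rewrite (bigD1 (Ordinal tn) (P := fun t' : 'I_nt => (t' < t.+1)%N)) //=.
      rewrite addrC; congr (_ + _); apply: eq_bigl => t'.
      by rewrite [in RHS]ltnS -val_eqE /= ltn_neqAle andbC.
  by move=> s2 _ sum i j; rewrite /= sum.
- by move=> s' _ I1 i j; rewrite I1; apply: eq_bigl => t; rewrite ltn_ord.
Qed.

(** The value [n] in register [r] signals failure. Ties go to the smallest index, as the strict last
    clause records; with a constant [val] the result is therefore the first index satisfying [P]. *)
Lemma wp_find r c v n (P : pred 'I_n) (val : 'I_n -> R) s :
  (n <= L)%N -> nreg s 1 = n -> r != 1%N -> r != 3 ->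
  (forall (i : 'I_n) s', frame [:: 3; r]%N [::] s s' -> nreg s' 3 = i ->
     beval s' c = P i) ->
  (forall (i : 'I_n) s' e, frame [:: 3; r]%N [::] s s' -> neval s' e = i ->
     reval s' (v e) = val i) ->
  wp L (Find r c v) (fun s' =>
    (nreg s' r = n /\ forall i, ~~ P i) \/
    exists q : 'I_n, [/\ nreg s' r = q, P q, forall i, P i -> val q <= val i &
      forall i : 'I_n, P i -> (i < q)%N -> val q < val i]) s.
Proof.
move=> nL s1 r1 r3 cP vV.
pose I k s' := (nreg s' r = n /\ forall i : 'I_n, (i < k)%N -> ~~ P i) \/
    exists q : 'I_n, [/\ nreg s' r = q, P q,
      forall i : 'I_n, (i < k)%N -> P i -> val q <= val i &
      forall i : 'I_n, P i -> (i < q)%N -> val q < val i].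
apply: wp_seq; apply: wp_nset.
set s0 := nupd s r _.
have fr0 : frame [:: 3; r]%N [::] s s0.
  by split=> //= r'; rewrite !inE negb_or => /andP[_ /negPf ->].
have f1 s' : frame [:: 3; r]%N [::] s s' -> nreg s' 1 = n.
  by move=> f'; rewrite f'.1 // !inE negb_or /= eq_sym.
have rL s' x : nreg (nupd s' 3 x) r = nreg s' r by rewrite /= (negPf r3).
apply: wp_conseq (wp_for (I := I) nL _ _ _ _) _ => //=.
- by rewrite inE eq_sym.
- move=> s' fr; apply: f1; apply: frame_trans fr0 _.
  by apply: frame_sub fr; list_subset.
- by left; rewrite rL /= eqxx s1.
- move=> i s' i1 fr s3 Ii.
  have frs : frame [:: 3; r]%N [::] s s'.
    by apply: frame_trans fr0 _; apply: frame_sub fr; list_subset.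
  have s'1 := f1 _ frs.
  have vi : reval s' (v (NReg 3)) = val (Ordinal i1) by apply: vV.
  have ci : beval s' c = P (Ordinal i1) by apply: cP.
  have iE (k : 'I_n) : (k < i.+1)%N -> (k < i)%N \/ k = Ordinal i1.
    rewrite ltnS leq_eqVlt => /orP[/eqP ki|]; [right|by left].
    exact: val_inj.
  apply: wp_if => /=; rewrite ci vi s'1.
    case/andP=> Pi cmp; apply: wp_nset; right; exists (Ordinal i1).
    rewrite rL /= eqxx s3; split=> //.
      move=> k /iE [ki|-> //] Pk.
      case: Ii => [[_ nP]|[q [rq Pq min _]]].
        by have := nP _ ki; rewrite Pk.
      move: cmp; rewrite rq -ltnNge ltn_ord /= (vV q) // -ltNge => /ltW lt.
      by apply: le_trans lt _; apply: min.
    move=> k Pk ki.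
    case: Ii => [[_ nP]|[q [rq Pq min _]]].
      by have := nP _ ki; rewrite Pk.
    move: cmp; rewrite rq -ltnNge ltn_ord /= (vV q) // -ltNge => lt.
    by apply: lt_le_trans lt _; apply: min.
  move=> cs; apply: wp_skip.
  case: Ii => [[rn nP]|[q [rq Pq min fst]]].
    left; rewrite rL; split=> // k /iE [ki|->]; first exact: nP.
    by move: cs; rewrite rn leqnn andbT.
  right; exists q; rewrite rL; split=> // k /iE [ki|->]; first exact: min.
  move=> Pi; move: cs.
  by rewrite Pi rq -ltnNge ltn_ord /= (vV q) // negbK.
- move=> s' _ [[rn nP]|[q [rq Pq min fst]]]; [left|right].
    by split=> // i; apply: nP.
  by exists q; split=> // i; apply: min.
Qed.

End Loops.

(** * Kernel projectors and conformal circuits *)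

Section Circuits.
Variable R : realFieldType.

(** The orthogonal projector on the subspace [V]; idempotence follows from the last two clauses. *)
Definition orth_projector n (V : 'cV[R]_n -> Prop) (P : 'M[R]_n) : Prop :=
  [/\ P^T = P, forall z, V z -> P *m z = z & forall z, V (P *m z)].

(* Intersecting V with the hyperplane a^T changes its projector by a matrix of
   rank at most one; if the denominator is 0, then so is P a^T. *)
Lemma orth_projector_hyperplane n (V : 'cV[R]_n -> Prop) P (a : 'rV[R]_n) q s :
  (forall k x y, V x -> V y -> V (x + k *: y)) ->
  q = P *m a^T -> s = (a *m q) 0 0 -> orth_projector V P ->
  orth_projector (fun z => V z /\ a *m z = 0) (P - s^-1 *: (q *m q^T)).
Proof.
move=> Vlin qE sE [Psym PV VP].
have qT : q^T = a *m P by rewrite qE trmx_mul trmxK Psym.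
have Vq : V q by rewrite qE.
have qq : q^T *m q = s%:M.
  by rewrite qT -mulmxA (PV _ Vq) sE; apply: mx11_scalar.
have q0 : s = 0 -> q = 0.
  move=> s0; apply/matrixP => i j; rewrite !mxE ord1; apply/eqP.
  have /eqP := congr1 (fun M : 'M_1 => M 0 0) qq.
  rewrite /= s0 !mxE eqxx mulr1n psumr_eq0 => [/allP/(_ i)|k _].
    by rewrite mem_index_enum mxE mulf_eq0 orbb; apply.
  by rewrite mxE -expr2 sqr_ge0.
split.
- by rewrite linearB /= linearZ /= trmx_mul trmxK Psym.
- move=> z [/PV Pz az].
  rewrite mulmxBl -scalemxAl -mulmxA qT -[in a *m P *m z]mulmxA.
  by rewrite Pz az mulmx0 scaler0 subr0.
- move=> z; have Pz : (P - s^-1 *: (q *m q^T)) *m z =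
      P *m z + (- (s^-1 * (q^T *m z) 0 0)) *: q.
    rewrite mulmxBl -scalemxAl -mulmxA {1}[q^T *m z]mx11_scalar mul_mx_scalar.
    by rewrite scalerA scaleNr.
  rewrite Pz; split; first exact: Vlin.
  rewrite mulmxDr -scalemxAr mulmxA -qT [a *m q]mx11_scalar -sE.
  rewrite {1}[q^T *m z]mx11_scalar scale_scalar_mx -raddfD /= mulNr mulrAC.
  have [/q0 ->|s0] := eqVneq s 0.
    by rewrite trmx0 mul0mx mxE mulr0 oppr0 addr0 raddf0.
  by rewrite mulVf // mul1r subrr raddf0.
Qed.

(** By symmetry and idempotence [P j j] is the squared norm of column [j]. Hence a nonzero vector of
    [V] can be found by testing the diagonal alone. *)
Lemma orth_projector_diag n V P (j : 'I_n) :
  orth_projector V P -> P j j = \sum_i P i j ^+ 2.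
Proof.
move=> [Psym PV VP].
have PP : P *m P = P.
  apply/matrixP => i k; have := PV _ (VP (delta_mx k 0)).
  rewrite -colE => /colP/(_ i); rewrite [in RHS]mxE => <-; rewrite !mxE.
  by apply: eq_bigr => l _; rewrite mxE.
rewrite -{1}PP mxE; apply: eq_bigr => i _.
by rewrite -{1}Psym mxE expr2.
Qed.

Lemma orth_projector_col n V P (j : 'I_n) :
  orth_projector V P -> P j j != 0 -> V (col j P) /\ col j P != 0.
Proof.
move=> pP Pj; split; first by rewrite colE; case: pP.
by apply: contraNneq Pj => /colP/(_ j); rewrite !mxE => ->.
Qed.

Lemma orth_projector_eq0 n V (P : 'M[R]_n) :
  orth_projector V P -> (forall j, P j j = 0) -> forall z, V z -> z = 0.
Proof.
move=> pP P0 z Vz; have [_ /(_ z Vz) <- _] := pP.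
suff -> : P = 0 by rewrite mul0mx.
apply/matrixP => i j; rewrite mxE.
have /eqP := P0 j; rewrite (orth_projector_diag _ pP) psumr_eq0.
  by move/allP/(_ i); rewrite mem_index_enum sqrf_eq0 => /(_ isT)/eqP.
by move=> k _; apply: sqr_ge0.
Qed.

(** These subspaces lead from the vectors supported in [S], whose projector is diagonal, to the
    kernel of [A] on [S], adding one row of [A] at a time. *)
Definition partial_kernel m n (A : 'M[R]_(m, n)) (S : pred 'I_n) (k : nat)
    (z : 'cV[R]_n) : Prop :=
  (forall i, ~~ S i -> z i 0 = 0) /\
  (forall r : 'I_m, (r < k)%N -> row r A *m z = 0).

Lemma partial_kernel0 m n (A : 'M[R]_(m, n)) (S : pred 'I_n) (P : 'M[R]_n) :
  (forall i j, P i j = if i == j then (S i)%:R else 0) ->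
  orth_projector (partial_kernel A S 0) P.
Proof.
move=> PE; have Pz (z : 'cV_n) i : (P *m z) i 0 = (S i)%:R * z i 0.
  rewrite mxE (bigD1 i) //= PE eqxx big1 ?addr0 // => j ji.
  by rewrite PE eq_sym (negPf ji) mul0r.
split.
- apply/matrixP => i j; rewrite mxE !PE eq_sym.
  by case: eqP => // ->.
- move=> z [zS _]; apply/colP => i; rewrite Pz.
  by case: (boolP (S i)) => [_|/zS ->]; rewrite ?mul1r ?mulr0.
- by move=> z; split=> // i /negPf Si; rewrite Pz Si mul0r.
Qed.

Lemma partial_kernelS m n (A : 'M[R]_(m, n)) S (r : 'I_m) P q s :
  orth_projector (partial_kernel A S r) P ->
  q = P *m (row r A)^T -> s = (row r A *m q) 0 0 ->
  orth_projector (partial_kernel A S r.+1) (P - s^-1 *: (q *m q^T)).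
Proof.
move=> pP qE sE.
have [|sym PV VP] := orth_projector_hyperplane _ qE sE pP.
  move=> k x y [xS xA] [yS yA]; split=> [i Si|r' r'k].
    by rewrite !mxE xS // yS // mulr0 addr0.
  by rewrite mulmxDr -scalemxAr xA // yA // scaler0 addr0.
split=> // z.
  move=> [zS zA]; apply: PV; split; last exact: zA.
  by split=> // r' lt; apply: zA; apply: ltnW.
have [[zS zA] za] := VP z; split=> // r'; rewrite ltnS leq_eqVlt.
by case/orP => [/eqP/val_inj -> //|]; apply: zA.
Qed.

Lemma partial_kernel_full m n (A : 'M[R]_(m, n)) S z :
  partial_kernel A S m z <-> (forall i, ~~ S i -> z i 0 = 0) /\ A *m z = 0.
Proof.
split=> -[zS zA]; split=> //.
  by apply/row_matrixP => r; rewrite row_mul zA // row0.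
by move=> r _; rewrite -row_mul zA row0.
Qed.

(** Sign compatibility, with a product in place of a case distinction on signs. *)
Definition conformal n (d g : 'cV[R]_n) : Prop :=
  forall i, (d i 0 = 0 -> g i 0 = 0) /\ 0 <= g i 0 * d i 0.

Definition dot n (c g : 'cV[R]_n) : R := \sum_i c i 0 * g i 0.

Lemma dotD n (c x y : 'cV[R]_n) k : dot c (x + k *: y) = dot c x + k * dot c y.
Proof.
rewrite /dot mulr_sumr -big_split /=; apply: eq_bigr => i _.
by rewrite !mxE; ring.
Qed.

Lemma conformal_refl n (d : 'cV[R]_n) : conformal d d.
Proof. by move=> i; split=> //; rewrite -expr2 sqr_ge0. Qed.

Lemma conformal_trans n (d g h : 'cV[R]_n) :
  conformal d g -> conformal g h -> conformal d h.
Proof.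
move=> dg gh i; have [d0 dg0] := dg i; have [g0 gh0] := gh i.
split=> [/d0/g0 //|].
have [/g0 ->|gN0] := eqVneq (g i 0) 0; first by rewrite mul0r.
have g2 : 0 < g i 0 ^+ 2 by rewrite exprn_even_gt0.
rewrite -(pmulr_lge0 _ g2).
have -> : h i 0 * d i 0 * g i 0 ^+ 2 = (h i 0 * g i 0) * (g i 0 * d i 0).
  by ring.
exact: mulr_ge0.
Qed.

(** From a kernel vector [h] supported in [supp g], subtract the multiple of [g] that cancels
    coordinate [e]. The result is supported away from [e], so it is 0, and [h] is a multiple of [g].
    Thus one kernel computation decides minimality. *)
Lemma elementary_of_trivial_kernel m n (A : 'M[R]_(m, n)) g e :
  A *m g = 0 -> g e 0 != 0 ->
  (forall z : 'cV[R]_n,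
     (forall i, ~~ ((i != e) && (g i 0 != 0)) -> z i 0 = 0) ->
     A *m z = 0 -> z = 0) ->
  elementary_vector A g.
Proof.
move=> Ag ge triv; split=> //.
  by apply: contraNneq ge => ->; rewrite mxE.
move=> [h [h0 Ah /properP[/subsetP sub [i ig ih]]]].
have hE : h - (h e 0 / g e 0) *: g = 0.
  apply: triv; last by rewrite mulmxBr -scalemxAr Ah Ag scaler0 subr0.
  move=> k; rewrite !mxE negb_and !negbK => /orP[/eqP ->|/eqP gk].
    by rewrite divfK // subrr.
  rewrite gk mulr0 subr0; apply/eqP; apply: contraTT isT => hk.
  by have := sub k; rewrite !inE gk eqxx => /(_ hk).
have {}hE : h = (h e 0 / g e 0) *: g by apply/eqP; rewrite -subr_eq0 hE.
move: ig ih; rewrite !inE negbK => gi; rewrite hE mxE mulf_eq0 (negPf gi) orbF.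
by move=> /eqP k0; move: h0; rewrite hE k0 scale0r eqxx.
Qed.

(** The invariant under which [d] is reduced to a circuit; the cost vector [c] expresses the one
    linear inequality that the circuit must inherit from [d]. *)
Definition circuit_candidate m n (A : 'M[R]_(m, n)) (c d g : 'cV[R]_n) : Prop :=
  [/\ A *m g = 0, g != 0, conformal d g & 0 <= dot c g].

(** Move from [g] along [u] until the first entry of sign opposite to [u] reaches 0, which happens
    at [q] by the ratio test. No entry changes sign on the way, and entry [e] is untouched, so the
    result is not 0. *)
Lemma candidate_shift m n (A : 'M[R]_(m, n)) c d g u e q :
  circuit_candidate A c d g -> A *m u = 0 -> 0 <= dot c u ->
  (forall i, ~~ ((i != e) && (g i 0 != 0)) -> u i 0 = 0) -> g e 0 != 0 ->
  u q 0 * g q 0 < 0 ->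
  (forall i, u i 0 * g i 0 < 0 -> - (g q 0 / u q 0) <= - (g i 0 / u i 0)) ->
  circuit_candidate A c d (g + (- (g q 0 / u q 0)) *: u) /\
  (#|supp (g + (- (g q 0 / u q 0)) *: u)%R| < #|supp g|)%N.
Proof.
move=> [Ag g0 dg cg] Au cu us ge ug min.
set l := - (g q 0 / u q 0).
have uq : u q 0 != 0 by apply: contraTneq ug => ->; rewrite mul0r ltxx.
have gq : g q 0 != 0 by apply: contraTneq ug => ->; rewrite mulr0 ltxx.
have l0 : 0 < l.
  have u2 : 0 < u q 0 ^+ 2 by rewrite exprn_even_gt0.
  rewrite -(pmulr_lgt0 _ u2) /l.
  have -> : - (g q 0 / u q 0) * u q 0 ^+ 2 = - (u q 0 * g q 0) by field.
  by rewrite oppr_gt0.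
split; first split.
- by rewrite mulmxDr -scalemxAr Ag Au scaler0 addr0.
- apply: contraNneq ge => /colP/(_ e); rewrite !mxE us ?eqxx //.
  by rewrite mulr0 addr0 => ->.
- apply: conformal_trans dg _ => i; split=> [gi|]; rewrite !mxE.
    by rewrite us ?gi ?eqxx ?andbF // mulr0 addr0.
  rewrite mulrDl -mulrA; have [ugi|ugi] := leP 0 (u i 0 * g i 0).
    by apply: addr_ge0; rewrite -?expr2 ?sqr_ge0 // mulr_ge0 // ltW.
  have ui : u i 0 != 0 by apply: contraTneq ugi => ->; rewrite mul0r ltxx.
  have := ler_wnM2r (ltW ugi) (min i ugi); rewrite -/l.
  rewrite (_ : - (g i 0 / u i 0) * _ = - (g i 0 * g i 0)); last by field.
  by rewrite -subr_ge0 opprK addrC.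
- by rewrite dotD addr_ge0 // mulr_ge0 // ltW.
apply: proper_card; apply/properP; split; last exists q; rewrite ?inE ?mxE //.
  apply/subsetP => i; rewrite !inE !mxE; apply: contraNneq => gi.
  by rewrite gi add0r us ?mulr0 // gi eqxx andbF.
by rewrite negbK mulNr divfK // subrr.
Qed.

(** If no entry of [u] opposes [g], moving along [u] is never blocked, but then [u] itself is
    conformal to [g] and lacks the entry [e]. *)
Lemma candidate_replace m n (A : 'M[R]_(m, n)) c d g u e :
  circuit_candidate A c d g -> A *m u = 0 -> u != 0 -> 0 <= dot c u ->
  (forall i, ~~ ((i != e) && (g i 0 != 0)) -> u i 0 = 0) -> g e 0 != 0 ->
  (forall i, 0 <= u i 0 * g i 0) ->
  circuit_candidate A c d u /\ (#|supp u| < #|supp g|)%N.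
Proof.
move=> [Ag g0 dg cg] Au u0 cu us ge ug; split; first split=> //.
  apply: conformal_trans dg _ => i; split=> // gi.
  by rewrite us // gi eqxx andbF.
apply: proper_card; apply/properP; split; last exists e; rewrite ?inE //.
  apply/subsetP => i; rewrite !inE; apply: contraNneq => gi.
  by rewrite us // gi eqxx andbF.
by rewrite us ?eqxx.
Qed.

Lemma card_supp_gt0 n (g : 'cV[R]_n) : g != 0 -> (0 < #|supp g|)%N.
Proof.
move=> g0; rewrite card_gt0; apply: contraNneq g0 => s0; apply/eqP/colP => i.
have := in_set0 i; rewrite -s0 inE mxE.
by move/negbFE/eqP.
Qed.

End Circuits.

(** * Circuit steps *)

Section Steps.
Variable R : realFieldType.

(** * Maximal steps, and independence of the columns in the support of a vertex *)

Section MaximalStep.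
Variables (m n : nat) (A : 'M[R]_(m, n)) (b : 'cV[R]_m).

(** The ratio test of the simplex method. Negation is written [0 - g i 0] because the programming
    language has subtraction only. *)
Lemma maximal_step x g q :
  in_polyhedron A b x -> A *m g = 0 -> (forall i, g i 0 < 0 -> 0 < x i 0) ->
  g q 0 < 0 ->
  (forall i, g i 0 < 0 -> x q 0 / (0 - g q 0) <= x i 0 / (0 - g i 0)) ->
  let a := x q 0 / (0 - g q 0) in
  [/\ 0 < a, in_polyhedron A b (x + a *: g), (x + a *: g) q 0 = 0 &
    forall a', a < a' -> ~ in_polyhedron A b (x + a' *: g)].
Proof.
move=> [Ax x0] Ag pos gq min a.
have a0 : 0 < a by rewrite divr_gt0 ?pos // sub0r oppr_gt0.
have yq : (x + a *: g) q 0 = 0.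
  by rewrite !mxE /a sub0r; field; rewrite lt_eqF.
split=> //.
  split=> [|i]; first by rewrite mulmxDr -scalemxAr Ag scaler0 addr0.
  rewrite !mxE; have [gi|gi] := leP 0 (g i 0).
    by rewrite addr_ge0 // mulr_ge0 // ltW.
  have := ler_wnM2r (ltW gi) (min i gi); rewrite -/a sub0r.
  have -> : x i 0 / - g i 0 * g i 0 = - x i 0 by field; rewrite lt_eqF.
  by rewrite -subr_ge0 opprK addrC.
move=> a' aa' [_ /(_ q)]; move: yq; rewrite !mxE => yq.
have : (a' - a) * g q 0 < 0 by rewrite pmulr_rlt0 // subr_gt0.
by move: yq; clear; move=> yq lt le; lra.
Qed.

Lemma circuit_walk_rcons x y k w w' g a :
  circuit_walk A b x y k w -> (forall i, (i <= k)%N -> w' i = w i) ->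
  w' k.+1 = y + a *: g -> elementary_vector A g -> 0 < a ->
  in_polyhedron A b (y + a *: g) ->
  (forall a', a < a' -> ~ in_polyhedron A b (y + a' *: g)) ->
  circuit_walk A b x (y + a *: g) k.+1 w'.
Proof.
move=> [w0 wk wP step] ww' w'k elg a0 yP max; split=> //.
- by rewrite ww'.
- move=> i; rewrite leq_eqVlt => /orP[/eqP -> //|]; first by rewrite w'k.
  by rewrite ltnS => ik; rewrite ww' //; apply: wP.
- move=> i; rewrite ltnS leq_eqVlt => /orP[/eqP ->|ik].
    have w'k0 : w' k = y by rewrite ww'.
    by exists g, a; rewrite w'k0; split.
  by rewrite !ww' ?(ltnW ik) //; apply: step.
Qed.

Definition independent (S : {set 'I_n}) : Prop :=
  forall z : 'cV[R]_n,
    (forall i, i \notin S -> z i 0 = 0) -> A *m z = 0 -> z = 0.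

Lemma independent_card (S : {set 'I_n}) : independent S -> (#|S| <= m)%N.
Proof.
move=> indep; pose B := colsub (@enum_val _ (mem S)) A.
suff : row_free B^T.
  by rewrite /row_free mxrank_tr => /eqP <-; apply: rank_leq_row.
apply: inj_row_free => y yB.
pose z := \sum_(k < #|S|) y 0 k *: (delta_mx (enum_val k) 0 : 'cV[R]_n).
have zE (k : 'I_#|S|) : z (enum_val k) 0 = y 0 k.
  rewrite /z summxE (bigD1 k) //= !mxE !eqxx mulr1 big1 ?addr0 // => l lk.
  by rewrite !mxE (inj_eq enum_val_inj) eq_sym (negPf lk) mulr0.
have : z = 0.
  apply: indep => [i iS|].
    rewrite /z summxE big1 // => k _; rewrite !mxE.
    case: eqP => [ik|]; last by rewrite mulr0.
    by move: iS; rewrite ik enum_valP.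
  apply/colP => r; rewrite [RHS]mxE.
  move/rowP/(_ r): yB; rewrite [RHS]mxE => <-.
  rewrite [RHS]mxE /z mulmx_sumr summxE; apply: eq_bigr => k _.
  by rewrite -scalemxAr -colE !mxE.
by move=> z0; apply/rowP => k; rewrite -zE z0 !mxE.
Qed.

(** A nonzero kernel vector [z] supported in [supp v] would make [v] the midpoint of the two
    feasible points [v + t z] and [v - t z]. *)
Lemma vertex_independent v : vertex A b v -> independent (supp v).
Proof.
move=> [[Av v0] extreme] z zS Az; apply/eqP/negPn/negP => zN0.
(* A positive number with [t * |z i| <= v i] for all [i]: the summand 1 keeps the denominators
   positive, and the minimum with 1 makes the product at most each of its factors. *)
pose t := \prod_(i in supp v) Num.min 1 (v i 0 / (1 + `|z i 0|)).
have pos i : i \in supp v -> 0 < Num.min 1 (v i 0 / (1 + `|z i 0|)) <= 1.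
  rewrite inE => vi; rewrite lt_min ltr01 ge_min lexx /=.
  by rewrite divr_gt0 ?ltr_wpDr // lt_def vi v0.
have t0 : 0 < t by apply: prodr_gt0 => i /pos/andP[].
have tz i : t * `|z i 0| <= v i 0.
  have [iS|iS] := boolP (i \in supp v); last first.
    by rewrite zS // normr0 mulr0.
  have le1 :
      \prod_(j in supp v | j != i) Num.min 1 (v j 0 / (1 + `|z j 0|)) <= 1.
    apply: prodr_ile1 => j /andP[/pos/andP[lt le] _].
    by rewrite le ltW.
  have d0 : 0 < 1 + `|z i 0| by rewrite ltr_wpDr.
  have /andP[mi0 _] := pos _ iS.
  rewrite /t (bigD1 i) //=; set p := \prod_(_ in _ | _) _ in le1 *.
  have : Num.min 1 (v i 0 / (1 + `|z i 0|)) * p <= v i 0 / (1 + `|z i 0|).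
    apply: le_trans (_ : Num.min 1 (v i 0 / (1 + `|z i 0|)) <= _); last first.
      by rewrite ge_min lexx orbT.
    by rewrite ler_piMr // ltW.
  rewrite ler_pdivlMr // => le; apply: le_trans le.
  rewrite mulrDr mulr1 lerDr mulr_ge0 ?(ltW mi0) //.
  by apply: prodr_ge0 => j /andP[/pos/andP[lt _] _]; rewrite ltW.
have inP e : `|e| = t -> in_polyhedron A b (v + e *: z).
  move=> eE; split; first by rewrite mulmxDr -scalemxAr Az scaler0 addr0.
  move=> i; rewrite !mxE; have := tz i.
  rewrite -eE -normrM -normrN => le.
  by rewrite -lerBlDr sub0r; apply: le_trans (ler_norm _) le.
have half : 0 < (2^-1 : R) < 1 by rewrite invr_gt0 invf_lt1 ?ltr0n // ltr1n.
have vE : v = 2^-1 *: (v + t *: z) + (1 - 2^-1) *: (v + - t *: z).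
  by apply/colP => i; rewrite !mxE; field.
have inPp := inP _ (gtr0_norm t0).
have inPm : in_polyhedron A b (v + - t *: z).
  by apply: inP; rewrite normrN gtr0_norm.
have [vt _] := extreme _ _ _ inPp inPm half vE.
move/eqP: vt; rewrite -subr_eq0 addrAC subrr add0r scaler_eq0 (negPf zN0) orbF.
by rewrite gt_eqF.
Qed.

Lemma eq_of_subset_supp v x :
  independent (supp v) -> in_polyhedron A b v -> in_polyhedron A b x ->
  (forall i, v i 0 = 0 -> x i 0 = 0) -> x = v.
Proof.
move=> indep [Av _] [Ax _] sub; apply/eqP; rewrite -subr_eq0; apply/eqP.
apply: indep; last by rewrite mulmxBr Ax Av subrr.
move=> i; rewrite inE negbK => /eqP vi.
by rewrite !mxE vi sub // subr0.
Qed.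

End MaximalStep.

(* A circuit g conformal to d has a nonnegative product with this vector iff
   its relative entry g/d at i2 is at least 1/K times the sum of all relative
   entries; the entries where d is 0 count as 1/0 = 0. *)
Definition ratio_cost n (K : R) (d : 'cV[R]_n) (i2 : 'I_n) : 'cV[R]_n :=
  \col_i ((if i == i2 then K / d i 0 else 0) - 1 / d i 0).

Lemma dot_ratio_cost n K (d g : 'cV[R]_n) i2 :
  dot (ratio_cost K d i2) g = K * (g i2 0 / d i2 0) - \sum_i g i 0 / d i 0.
Proof.
rewrite /dot (bigD1 i2) //= [in RHS](bigD1 i2) //= !mxE eqxx opprD addrA.
congr (_ + _); first by ring.
by rewrite -sumrN; apply: eq_bigr => i /negPf ii2; rewrite !mxE ii2; ring.
Qed.

(** For [g = d] the relative entries on [supp d] are all 1, so the inequality reads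
    [#|supp d| <= K]. This makes [d] itself a valid first candidate. *)
Lemma ratio_cost_self n K (d : 'cV[R]_n) i2 :
  d i2 0 != 0 -> #|supp d|%:R <= K -> 0 <= dot (ratio_cost K d i2) d.
Proof.
move=> d0 dK; rewrite dot_ratio_cost divff // mulr1 subr_ge0.
apply: le_trans dK; rewrite -sum1_card natr_sum [in leRHS]big_mkcond /=.
apply: ler_sum => i _; rewrite inE; case: eqP => [->|/eqP di] /=.
  by rewrite mul0r.
by rewrite divff.
Qed.

(** The relative entries are nonnegative by conformality, so each is at most their sum, which the
    cost inequality bounds by [K * r i2]. If [r i2] were 0, all of [g] would vanish. *)
Lemma candidate_ratio m n (A : 'M[R]_(m, n)) K d g i2 :
  0 <= K -> circuit_candidate A (ratio_cost K d i2) d g ->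
  exists r : 'I_n -> R, [/\ forall i, 0 <= r i, forall i, g i 0 = r i * d i 0,
    forall i, r i <= K * r i2 & 0 < r i2].
Proof.
move=> K0 [Ag g0 dg]; rewrite dot_ratio_cost subr_ge0 => sum_le.
pose r i := g i 0 / d i 0.
have r0 i : 0 <= r i.
  have [_ gd] := dg i; have [di|di] := eqVneq (d i 0) 0.
    by rewrite /r di invr0 mulr0.
  have d2 : 0 < d i 0 ^+ 2 by rewrite exprn_even_gt0.
  rewrite -(pmulr_lge0 _ d2) /r.
  by have -> : g i 0 / d i 0 * d i 0 ^+ 2 = g i 0 * d i 0 by field.
have gr i : g i 0 = r i * d i 0.
  have [gi _] := dg i; have [di|di] := eqVneq (d i 0) 0.
    by rewrite gi // di mulr0.
  by rewrite /r divfK.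
have rK i : r i <= K * r i2.
  apply: le_trans sum_le; rewrite (bigD1 i) //= lerDl.
  by apply: sumr_ge0 => j _; apply: r0.
exists r; split=> //.
rewrite lt_def r0 andbT; apply: contraNneq g0 => ri2; apply/eqP/colP => i.
rewrite mxE gr; have := rK i; rewrite ri2 mulr0 => ri.
have -> : r i = 0 by apply/eqP; rewrite eq_le ri r0.
by rewrite mul0r.
Qed.

(** * The effect of a single step within a phase *)

Section Phase.
Variables (m n : nat) (A : 'M[R]_(m, n)) (b : 'cV[R]_m) (v : 'cV[R]_n) (K : R).


Definition excess_set (x : 'cV[R]_n) : {set 'I_n} :=
  [set i | (K + K) * v i 0 < x i 0].

(** Put [rho i = a * r i], so that [x i] moves by [rho i * (v i - x i)]. As [x i2] stays
    nonnegative, [rho i2 <= 2], hence every [rho i <= 2K]; this is why large means above [2K * v i].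
    The blocking coordinate has [rho q >= 1], hence [rho i2 >= 1/K], and [x i2 - v i2 >= x i2 / 2]
    gives the factor [1 - 1/(2K)]. *)
Lemma geometric_step (x g : 'cV[R]_n) (a : R) (q i2 : 'I_n) :
  4 <= K -> in_polyhedron A b v -> in_polyhedron A b x -> i2 \in excess_set x ->
  circuit_candidate A (ratio_cost K (v - x) i2) (v - x) g ->
  0 <= a -> g q 0 < 0 -> in_polyhedron A b (x + a *: g) ->
  (x + a *: g) q 0 = 0 ->
  excess_set (x + a *: g) \subset excess_set x /\
  (x + a *: g) i2 0 <= (1 - (K + K)^-1) * x i2 0.
Proof.
move=> K4 [_ v0] [_ x0] i2U cand a0 gq [_ y0] yq.
have K0 : 0 <= K by lra.
have [r [r0 gr rK ri2]] := candidate_ratio K0 cand.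
have yE i : (x + a *: g) i 0 = x i 0 + a * r i * (v i 0 - x i 0).
  by rewrite !mxE gr !mxE; ring.
move: i2U; rewrite inE => i2U.
have v2 := v0 i2.
have x2 : x i2 0 <= 2 * (x i2 0 - v i2 0) by nra.
have ar2 : a * r i2 <= 2.
  rewrite leNgt; apply/negP => lt.
  have : 0 <= x i2 0 + a * r i2 * (v i2 0 - x i2 0) by rewrite -yE.
  by nra.
have arK i : a * r i <= K + K.
  have := ler_wpM2l a0 (rK i).
  have : K * (a * r i2) <= K * 2 by rewrite ler_wpM2l.
  by move=> ? ?; lra.
have ar0 i : 0 <= a * r i by rewrite mulr_ge0.
split.
  apply/subsetP => i; rewrite !inE yE; apply: contraTT; rewrite -!leNgt => xi.
  have vi := v0 i; have xi0 := x0 i; have ai := ar0 i; have aK := arK i.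
  have [vx|vx] := leP (v i 0) (x i 0); first by nra.
  have : a * r i * (v i 0 - x i 0) <= (K + K) * (v i 0 - x i 0).
    by rewrite ler_wpM2r // subr_ge0 ltW.
  by nra.
have aq : 1 <= a * r q.
  rewrite leNgt; apply/negP => lt.
  move: gq; rewrite gr !mxE => gq; have rq := r0 q; have vq := v0 q.
  have xq : v q 0 < x q 0 by nra.
  by move: yq; rewrite yE; have := ar0 q; nra.
have aK2 : 1 <= K * (a * r i2).
  apply: le_trans aq _; rewrite mulrCA; exact: ler_wpM2l.
have Ki : K * K^-1 = 1 by rewrite mulfV //; lra.
have Ki0 : 0 < K^-1 by rewrite invr_gt0; lra.
have KKi : (K + K)^-1 = K^-1 / 2 by field; lra.
have ai2 : K^-1 <= a * r i2.
  by rewrite -[leLHS]mulr1 -[leRHS](mulKf (_ : K != 0)) ?ler_pM2l //; lra.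
rewrite yE KKi.
have : K^-1 * (x i2 0 - v i2 0) <= a * r i2 * (x i2 0 - v i2 0).
  by rewrite ler_wpM2r //; nra.
by nra.
Qed.

(* Relative to x0, the i2-th coordinate is so small that the step moves no
   coordinate outside excess_set x by more than v/2; and those of them that are
   below v/2 do not decrease, since the summand (v - x) *+ 4K of the direction
   dominates. *)
Lemma final_step (x0 x g : 'cV[R]_n) (a : R) (q i2 : 'I_n)
    (d := (v - x0) + (4 * K) *: (v - x)) :
  4 <= K -> in_polyhedron A b v -> in_polyhedron A b x0 ->
  in_polyhedron A b x -> excess_set x = excess_set x0 ->
  i2 \in excess_set x -> x i2 0 <= K^-1 ^+ 6 * x0 i2 0 ->
  circuit_candidate A (ratio_cost K d i2) d g ->
  (forall i, g i 0 < 0 -> 0 < x i 0) /\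
  (0 <= a -> g q 0 < 0 -> in_polyhedron A b (x + a *: g) ->
  (x + a *: g) q 0 = 0 ->
  excess_set (x + a *: g) \proper excess_set x).
Proof.
move=> K4 [_ v0] [_ x00] [_ xge0] /setP UU i2U small cand.
have K0 : 0 <= K by lra.
have [r [r0 gr rK ri2]] := candidate_ratio K0 cand.
have yE e i : (x + e *: g) i 0 =
    x i 0 + e * r i * ((v i 0 - x0 i 0) + 4 * K * (v i 0 - x i 0)).
  by rewrite !mxE gr /d !mxE; ring.
have dE i : d i 0 = (v i 0 - x0 i 0) + 4 * K * (v i 0 - x i 0).
  by rewrite /d !mxE.
have i2U0 : i2 \in excess_set x0 by rewrite -UU.
have inN i : i \notin excess_set x ->
    x i 0 <= (K + K) * v i 0 /\ x0 i 0 <= (K + K) * v i 0.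
  by move=> iN; have := iN; rewrite UU; move: iN; rewrite !inE -!leNgt.
(* If [2 * x i <= v i], then [4K * (v i - x i) >= 2K * v i >= x0 i] and [d i] is nonnegative; this
   fixes the weight [4K] in [d]. *)
have posN i : i \notin excess_set x -> d i 0 < 0 -> v i 0 < 2 * x i 0.
  move=> /inN [xi x0i]; rewrite dE => di; have vi := v0 i.
  rewrite ltNge; apply/negP => le; move: di; apply/negP; rewrite -leNgt.
  by nra.
have gneg i : g i 0 < 0 -> d i 0 < 0.
  by rewrite gr => gi; have ri := r0 i; nra.
split.
  move=> i /gneg di; have [|iU] := boolP (i \in excess_set x).
    by rewrite inE => iU; have vi := v0 i; nra.
  by have := posN _ iU di; have := v0 i; lra.
move=> a0 gq [_ y0] yq.
have v2 := v0 i2.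
have ar0 i : 0 <= a * r i by rewrite mulr_ge0.
have d2 : x0 i2 0 <= 2 * (- d i2 0).
  move: i2U i2U0; rewrite !inE dE => h h0.
  have Kv : 4 * v i2 0 <= K * v i2 0 by rewrite ler_wpM2r.
  have : 0 <= K * (x i2 0 - v i2 0) by rewrite mulr_ge0 // subr_ge0; lra.
  by move=> ?; lra.
have Ki0 : 0 < K^-1 by rewrite invr_gt0; lra.
have KN0 : K != 0 by rewrite gt_eqF //; lra.
have x02 : 0 < x0 i2 0.
  by move: i2U0; rewrite inE => h; nra.
(* Nonnegativity of the new entry at [i2] gives [a * r i2 <= x i2 / (- d i2)], where
   [x i2 <= x0 i2 / K^6] and [- d i2 >= x0 i2 / 2]. *)
have ar2 : a * r i2 <= 2 * K^-1 ^+ 6.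
  rewrite leNgt; apply/negP => lt.
  have : 0 <= x i2 0 + a * r i2 * d i2 0 by rewrite dE -yE.
  have p6 : 0 < K^-1 ^+ 6 by rewrite exprn_gt0.
  set D := d i2 0 in d2 *; set p := K^-1 ^+ 6 in p6 lt small *.
  have D0 : D < 0 by lra.
  have : a * r i2 * D < 2 * p * D by rewrite ltr_nM2r.
  have : p * x0 i2 0 <= p * (2 * - D) by rewrite ler_pM2l.
  by move=> ? ? ?; lra.
have arK i : a * r i <= 2 * K^-1 ^+ 5.
  have -> : 2 * K^-1 ^+ 5 = K * (2 * K^-1 ^+ 6) :> R by field.
  apply: le_trans (ler_wpM2l a0 (rK i)) _.
  by rewrite mulrCA; apply: ler_wpM2l.
(* The move is at most [2 K^-5 * 10 K^2 * v i = 20 K^-3 * v i], and [20/64 < 1/2] for [K >= 4]. With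
   5 in place of the exponent 6 the same count would only give [20/16]. *)
have bound i : i \notin excess_set x -> `|a * r i * d i 0| <= v i 0 / 2.
  move=> /inN [xi x0i]; have vi := v0 i.
  have xi0 := xge0 i; have x0i0 := x00 i.
  have nd : `|d i 0| <= 10 * K ^+ 2 * v i 0.
    rewrite dE ler_norml; apply/andP; split; nra.
  rewrite normrM ger0_norm //.
  apply: le_trans (ler_pM _ _ (arK i) nd) _ => //.
  have -> : 2 * K^-1 ^+ 5 * (10 * K ^+ 2 * v i 0) = 20 * K^-1 ^+ 3 * v i 0 :> R.
    by field.
  have Kp : 0 < K by lra.
  have Ki4 : K^-1 <= 4^-1 by rewrite lef_pV2 // posrE ltr0n.
  have : K^-1 ^+ 3 <= 4^-1 ^+ 3.
    by rewrite lerXn2r // nnegrE ?invr_ge0 ?ler0n // ltW.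
  move=> /(ler_wpM2r vi); set p := K^-1 ^+ 3 * _ => K3.
  have -> : 20 * K^-1 ^+ 3 * v i 0 = 20 * p by rewrite /p mulrA.
  by move: K3; rewrite !exprS expr0; lra.
apply/properP; split.
  apply/subsetP => i; apply: contraTT => iN.
  have [xi x0i] := inN _ iN.
  have := bound _ iN; rewrite ler_norml => /andP[_ ub].
  rewrite inE -leNgt yE -dE; have vi := v0 i.
  (* Up to [2 * v i] a move by [v i / 2] stays below the threshold; beyond it the entry does not
     increase. *)
  have [le|lt] := leP (x i 0) (2 * v i 0); first by nra.
  have di : d i 0 <= 0 by rewrite dE; have := x00 i; nra.
  by have := ar0 i; nra.
exists q; last by rewrite inE -leNgt yq mulr_ge0 //; lra.
(* A decreasing coordinate that is not large starts above [v q / 2] and loses at most [v q / 2], so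
   it cannot reach 0. *)
apply/negPn/negP => qN; have dq := gneg _ gq.
have := bound _ qN; rewrite ler_norml => /andP[lb _].
have := posN _ qN dq; move: yq; rewrite yE -dE => yq lt; lra.
Qed.

End Phase.
End Steps.

(** * Computing kernel vectors *)

Definition NEq e1 e2 := BAnd (BNLe e1 e2) (BNLe e2 e1).
Definition BLt e1 e2 := BNot (BRLe e2 e1).
Definition BNe0 e := BNot (BAnd (BRLe e RZero) (BRLe RZero e)).
Definition BFound r := BNot (BNLe (NReg 1) (NReg r)).
Definition rv a e := RGet a e (NConst 0).
Definition VMap a c e e' := Map a (NReg 1) (NConst 1) c e e'.
Definition Assign a e := VMap a BTrue e RZero.
Definition no_val (_ : nexp) := RZero.

(* Array 0 is A; after the loop, array 8 is the projector on the kernel of A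
   with support in the set selected by the condition S on register 3. *)
Definition Proj S :=
  Seq (Map 8 (NReg 1) (NReg 1) (BAnd (NEq (NReg 3) (NReg 4)) S) ROne RZero)
  (For 6 (NReg 0)
    (Seq (Acc 9 (NReg 1) (NConst 1) (NReg 1)
            (RMul (RGet 8 (NReg 3) (NReg 5)) (RGet 0 (NReg 6) (NReg 5))))
    (Seq (Acc 10 (NConst 1) (NConst 1) (NReg 1)
            (RMul (RGet 0 (NReg 6) (NReg 5)) (rv 9 (NReg 5))))
         (Map 8 (NReg 1) (NReg 1) BTrue
            (RSub (RGet 8 (NReg 3) (NReg 4))
               (RDiv (RMul (rv 9 (NReg 3)) (rv 9 (NReg 4)))
                  (rv 10 (NConst 0)))) RZero)))).

(** A column of the projector with nonzero diagonal entry is a nonzero kernel vector; if there is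
    none, the kernel on [S] is trivial. Register 7 holds the column index. *)
Definition Ker S :=
  Seq (Proj S) (Find 7 (BNe0 (RGet 8 (NReg 3) (NReg 3))) no_val).

Section Subroutines.
Variables (R : realFieldType) (m n L : nat) (A : 'M[R]_(m, n)).
Hypotheses (mL : (m <= L)%N) (nL : (n <= L)%N) (L1 : (1 <= L)%N).
Implicit Types (s : store R) (S : bexp) (P : pred 'I_n).

Definition vec s a : 'cV[R]_n := \col_i rarr s a i 0.

Definition has_input s : Prop :=
  [/\ nreg s 0 = m, nreg s 1 = n &
      forall i j, rarr s 0 i j = array_of_mx A i j].

Lemma array_of_mxE (i : 'I_m) (j : 'I_n) : array_of_mx A i j = A i j.
Proof. by rewrite /array_of_mx !valK. Qed.

Lemma vec_frame rs arrs s s' a :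
  frame rs arrs s s' -> a \notin arrs -> vec s' a = vec s a.
Proof. by move=> fr aN; apply/colP => i; rewrite !mxE fr.2. Qed.

Lemma has_input_frame rs arrs s s' :
  frame rs arrs s s' -> 0%N \notin rs -> 1%N \notin rs -> 0%N \notin arrs ->
  has_input s -> has_input s'.
Proof.
move=> fr r0 r1 a0 [mE nE AE]; split; rewrite ?fr.1 // => i j.
by rewrite fr.2.
Qed.

Lemma beval_NEq s e1 e2 : beval s (NEq e1 e2) = (neval s e1 == neval s e2).
Proof. by rewrite /= -eqn_leq. Qed.

Lemma beval_BNe0 s e : beval s (BNe0 e) = (reval s e != 0).
Proof. by rewrite /= -eq_le. Qed.

Lemma beval_BLt s e1 e2 : beval s (BLt e1 e2) = (reval s e1 < reval s e2).
Proof. by rewrite /= -ltNge. Qed.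

Lemma wp_vmap a c e e' (F : 'I_n -> R) s :
  nreg s 1 = n ->
  (forall (i : 'I_n) s', frame [:: 3; 4]%N [:: a] s s' -> nreg s' 3 = i ->
     rarr s' a i 0 = rarr s a i 0 ->
     (if beval s' c then reval s' e else reval s' e') = F i) ->
  wp L (VMap a c e e') (fun s' => vec s' a = \col_i F i) s.
Proof.
move=> s1 cell; apply: wp_conseq.
  apply: (wp_map (n1 := n) (n2 := 1) (F := fun i _ => F i)) => //.
    by move=> s' fr /=; rewrite fr.1.
  by move=> i j s' fr r3 r4; rewrite ord1; apply: cell.
move=> s' _ cellE; apply/colP => i; rewrite !mxE.
exact: (cellE i ord0).
Qed.

Lemma wp_assign a e (F : 'I_n -> R) s :
  nreg s 1 = n ->
  (forall (i : 'I_n) s', frame [:: 3; 4]%N [:: a] s s' -> nreg s' 3 = i ->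
     rarr s' a i 0 = rarr s a i 0 -> reval s' e = F i) ->
  wp L (Assign a e) (fun s' => vec s' a = \col_i F i) s.
Proof. by move=> s1 cell; apply: wp_vmap. Qed.

Lemma wp_scalar_acc a nt et e (F : 'I_nt -> R) s :
  (nt <= L)%N ->
  (forall s', frame [:: 3; 4; 5]%N [:: a] s s' -> neval s' et = nt) ->
  (forall (t : 'I_nt) s', frame [:: 3; 4; 5]%N [:: a] s s' ->
     nreg s' 5 = t -> reval s' e = F t) ->
  wp L (Acc a (NConst 1) (NConst 1) et e)
    (fun s' => rarr s' a 0 0 = \sum_t F t) s.
Proof.
move=> ntL etE cell; apply: wp_conseq.
  apply: (wp_acc (n1 := 1) (n2 := 1) (nt := nt) (F := fun t _ _ => F t)) => //.
  by move=> t i j s' fr _ _; apply: cell.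
by move=> s' _ /(_ ord0 ord0).
Qed.

Lemma wp_proj S P s :
  has_input s ->
  (forall (i : 'I_n) s', frame [:: 3; 4]%N [:: 8]%N s s' -> nreg s' 3 = i ->
     beval s' S = P i) ->
  wp L (Proj S) (fun s' => orth_projector (partial_kernel A P m)
    (\matrix_(i, j) rarr s' 8 i j)) s.
Proof.
move=> inp SP; have [mE nE AE] := inp.
apply: wp_seq; apply: wp_conseq.
  apply: (wp_map (n1 := n) (n2 := n)
    (F := fun i j => if i == j then (P i)%:R else 0)) => //.
  - by move=> s' fr /=; rewrite fr.1.
  - by move=> s' fr /=; rewrite fr.1.
  - move=> i j s' fr r3 r4 _.
    have -> : beval s' (BAnd (NEq (NReg 3) (NReg 4)) S) = (i == j) && P i.
      by rewrite -(SP _ _ fr r3) -val_eqE /= r3 r4 -eqn_leq.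
    by case: eqP => //= _; case: (P i).
move=> s0 fr0 diag.
pose I k s' := orth_projector (partial_kernel A P k)
  (\matrix_(i, j) rarr s' 8 i j).
apply: (wp_for (I := I)) => //.
- by move=> s' fr /=; rewrite fr.1 // fr0.1.
- apply: partial_kernel0 => i j; rewrite mxE /=.
  exact: diag.
- move=> r s' rm fr r6 pP.
  have {}fr := (has_input_frame fr isT isT isT
    (has_input_frame fr0 isT isT isT inp)).
  have [s'0 s'1 s'A] := fr.
  rewrite /I in pP; set M := \matrix_(i, j) _ in pP.
  pose r' := Ordinal rm.
  have rowE (t : 'I_n) : rarr s' 0 r t = row r' A 0 t.
    by rewrite s'A -[r]/(val r') array_of_mxE mxE.
  (* The data of the rank-one update for row [r], to be held in arrays 9 and 10. *)
  pose q := M *m (row r' A)^T.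
  pose sigma := (row r' A *m q) 0 0.
  apply: wp_seq; apply: wp_conseq.
    apply: (wp_acc (n1 := n) (n2 := 1) (nt := n)
      (F := fun t i _ => M i t * row r' A 0 t)) => //.
    + by move=> s2 f2 /=; rewrite f2.1.
    + by move=> s2 f2 /=; rewrite f2.1.
    + move=> t i j s2 f2 r3 r4 r5 /=.
      by rewrite r3 r5 !f2.2 // f2.1 // r6 rowE [M i t]mxE.
  move=> s1 f1 qE.
  have {}qE (i : 'I_n) : rarr s1 9 i 0 = q i 0.
    rewrite (qE i ord0) [RHS]mxE; apply: eq_bigr => t _.
    by rewrite [(row r' A)^T t 0]mxE.
  have rE1 : nreg s1 6 = r by rewrite f1.1.
  have s11 : nreg s1 1 = n by rewrite f1.1.
  have A1 (t : 'I_n) : rarr s1 0 r t = row r' A 0 t by rewrite f1.2.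
  apply: wp_seq; apply: wp_conseq.
    apply: (wp_scalar_acc (nt := n) (F := fun t => row r' A 0 t * q t 0)) => //.
    + by move=> s2 f2 /=; rewrite f2.1.
    + move=> t s2 f2 r5 /=.
      by rewrite r5 !f2.2 // f2.1 // rE1 A1 qE.
  move=> s2 f2 sE.
  have {}sE : rarr s2 10 0 0 = sigma by rewrite sE /sigma mxE.
  have s21 : nreg s2 1 = n by rewrite f2.1.
  apply: wp_conseq.
    apply: (wp_map (n1 := n) (n2 := n)
      (F := (M - sigma^-1 *: (q *m q^T)))) => //.
    + by move=> s3 f3 /=; rewrite f3.1.
    + by move=> s3 f3 /=; rewrite f3.1.
    + move=> i j s3 f3 r3 r4 /=; rewrite r3 r4 => ->.
      rewrite !f3.2 // sE !f2.2 // !qE f1.2 // !mxE big_ord1 !mxE.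
      by rewrite mulrC.
  move=> s3 f3 PE; rewrite /I.
  rewrite (_ : \matrix_(i, j) _ = M - sigma^-1 *: (q *m q^T)).
    exact: (partial_kernelS (r := r') pP).
  by apply/matrixP => i j; rewrite [LHS]mxE /= PE.
Qed.

Definition kernel_vector P (u : 'cV[R]_n) : Prop :=
  [/\ u != 0, A *m u = 0 & forall i, ~~ P i -> u i 0 = 0].

Definition kernel_found P s : Prop :=
  (nreg s 7 = n /\ forall z : 'cV[R]_n,
     (forall i, ~~ P i -> z i 0 = 0) -> A *m z = 0 -> z = 0) \/
  exists p : 'I_n, nreg s 7 = p /\ kernel_vector P (\col_i rarr s 8 i p).

Lemma wp_ker S P s :
  has_input s ->
  (forall (i : 'I_n) s', frame [:: 3; 4]%N [:: 8]%N s s' -> nreg s' 3 = i ->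
     beval s' S = P i) ->
  wp L (Ker S) (kernel_found P) s.
Proof.
move=> inp SP; apply: wp_seq; apply: wp_conseq (wp_proj inp SP) _.
move=> s1 f1 pP; have [_ s11 _] := has_input_frame f1 isT isT isT inp.
apply: wp_conseq.
  apply: (wp_find (n := n) (P := fun i => rarr s1 8 i i != 0)
    (val := fun _ => 0)) => // i s' fr r3.
  by rewrite beval_BNe0 /= r3 fr.2.
move=> s2 f2 [[r7 none]|[p [r7 Pp _ _]]].
  left; split=> // z zP Az; apply: (orth_projector_eq0 pP).
    by move=> j; rewrite mxE; apply/eqP/negPn/none.
  exact/partial_kernel_full.
right; exists p; split=> //.
set M := \matrix_(i, j) _ in pP.
have Mp : M p p != 0 by rewrite mxE.
have [Vp u0] := orth_projector_col pP Mp.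
have -> : (\col_i rarr s2 8 i p) = col p M.
  by apply/colP => i; rewrite !mxE f2.2.
by have [uP Au] := (partial_kernel_full _ _ _).1 Vp.
Qed.

End Subroutines.

(** * Computing circuits and maximal steps *)

(* Array 13 becomes plus or minus the kernel vector found, whichever has a
   nonnegative product with the cost vector in array 11. *)
Definition Signed :=
  Seq (Acc 15 (NConst 1) (NConst 1) (NReg 1)
         (RMul (rv 11 (NReg 5)) (RGet 8 (NReg 5) (NReg 7))))
      (VMap 13 (BRLe RZero (rv 15 (NConst 0))) (RGet 8 (NReg 3) (NReg 7))
         (RSub RZero (RGet 8 (NReg 3) (NReg 7)))).

(** Tests minimality of the support of array 7: a nonzero coordinate, kept in register 8, is
    removed, and a kernel vector is sought on the rest of the support. *)
Definition CircTest :=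
  Seq (Find 8 (BNe0 (rv 7 (NReg 3))) no_val)
      (Ker (BAnd (BNot (NEq (NReg 3) (NReg 8))) (BNe0 (rv 7 (NReg 3))))).

(* Reduces the vector in array 7 to a circuit conformal to it without making
   its product with array 11 negative. *)
Definition Circ :=
  Seq CircTest
  (While (BFound 7)
    (Seq Signed
    (Seq (Find 9 (BLt (RMul (rv 13 (NReg 3)) (rv 7 (NReg 3))) RZero)
            (fun e => RSub RZero (RDiv (rv 7 e) (rv 13 e))))
    (Seq (If (BFound 9)
            (Seq (RSet 15 (NConst 0) (NConst 0)
                    (RSub RZero (RDiv (rv 7 (NReg 9)) (rv 13 (NReg 9)))))
                 (Assign 7 (RAdd (rv 7 (NReg 3))
                    (RMul (rv 15 (NConst 0)) (rv 13 (NReg 3))))))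
            (Assign 7 (rv 13 (NReg 3))))
         CircTest)))).

Definition Record := For 4 (NReg 1) (RSet 4 (NReg 2) (NReg 4) (rv 2 (NReg 4))).

Definition Step :=
  Seq (Find 9 (BLt (rv 7 (NReg 3)) RZero)
         (fun e => RDiv (rv 2 e) (RSub RZero (rv 7 e))))
  (Seq (RSet 15 (NConst 0) (NConst 0)
          (RDiv (rv 2 (NReg 9)) (RSub RZero (rv 7 (NReg 9)))))
  (Seq (Assign 2 (RAdd (rv 2 (NReg 3))
          (RMul (rv 15 (NConst 0)) (rv 7 (NReg 3)))))
  (Seq (NSet 2 (NAdd (NReg 2) (NConst 1)))
       Record))).

Section CircuitRoutine.
Variables (R : realFieldType) (m n L : nat) (A : 'M[R]_(m, n)).
Hypotheses (mL : (m <= L)%N) (nL : (n <= L)%N) (L1 : (1 <= L)%N).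
Implicit Types (s : store R) (P : pred 'I_n).

Lemma wp_signed P s (p : 'I_n) :
  has_input A s -> nreg s 7 = p ->
  kernel_vector A P (\col_i rarr s 8 i p) ->
  wp L Signed (fun s' => kernel_vector A P (vec n s' 13) /\
    0 <= dot (vec n s 11) (vec n s' 13)) s.
Proof.
move=> inp s7 [u0 Au uP]; have [mE nE AE] := inp.
set u := \col_i _ in u0 Au uP *.
apply: wp_seq; apply: wp_conseq.
  apply: (wp_scalar_acc L1 (nt := n)
    (F := fun t => vec n s 11 t 0 * u t 0)) => //.
    by move=> s' fr /=; rewrite fr.1.
  move=> t s' fr r5 /=.
  by rewrite r5 fr.1 // s7 !fr.2 // !mxE.
move=> s1 f1 zE; rewrite -/(dot (vec n s 11) u) in zE.
apply: wp_conseq.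
  apply: (wp_vmap nL L1 (F := fun i => if 0 <= dot (vec n s 11) u then u i 0
                                  else - u i 0)).
    by rewrite f1.1.
  move=> i s' fr r3 _ /=.
  rewrite r3 (fr.1 7%N) // (f1.1 7%N) // s7.
  rewrite (fr.2 15%N) // zE (fr.2 8%N) // (f1.2 8%N) // sub0r.
  by rewrite mxE.
move=> s2 f2 ->; case: (leP 0 (dot (vec n s 11) u)) => du.
  by rewrite (_ : \col_i _ = u) //; apply/colP => i; rewrite mxE.
rewrite (_ : \col_i _ = - u); last by apply/colP => i; rewrite !mxE.
split; first split.
- by rewrite oppr_eq0.
- by rewrite mulmxN Au oppr0.
- by move=> i /uP ui; rewrite mxE ui oppr0.
- have := dotD (vec n s 11) 0 u (-1).
  rewrite add0r scaleN1r mulN1r => ->.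
  have -> : dot (vec n s 11) (0 : 'cV_n) = 0.
    by rewrite /dot big1 // => i _; rewrite [X in _ * X]mxE mulr0.
  by rewrite add0r oppr_ge0 ltW.
Qed.

Definition circ_state (c d : 'cV[R]_n) s : Prop :=
  exists e : 'I_n, [/\ nreg s 8 = e, vec n s 7 e 0 != 0 &
    kernel_found A (fun i => (i != e) && (vec n s 7 i 0 != 0)) s].

Lemma wp_circ_test c d s :
  has_input A s -> vec n s 11 = c -> circuit_candidate A c d (vec n s 7) ->
  wp L CircTest (circ_state c d) s.
Proof.
move=> inp s11 cand; have [mE nE AE] := inp.
set g := vec n s 7 in cand *.
apply: wp_seq; apply: wp_conseq.
  apply: (wp_find (n := n) (P := fun i => g i 0 != 0)
    (val := fun _ => 0)) => //.
  by move=> i s' fr r3; rewrite beval_BNe0 /= r3 fr.2 // mxE.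
move=> s1 f1 [[_ none]|[e [r8 ge _ _]]].
  have [_ /eqP g0 _ _] := cand; case: g0; apply/colP => i; rewrite [RHS]mxE.
  exact/eqP/negPn/none.
have g1 : vec n s1 7 = g by rewrite (vec_frame n f1).
apply: wp_conseq.
  apply: (wp_ker mL nL L1 (P := fun i => (i != e) && (g i 0 != 0))).
    exact: has_input_frame f1 _ _ _ inp.
  move=> i s' fr r3.
  have -> : beval s' (BAnd (BNot (NEq (NReg 3) (NReg 8)))
      (BNe0 (rv 7 (NReg 3)))) =
      ~~ beval s' (NEq (NReg 3) (NReg 8)) && beval s' (BNe0 (rv 7 (NReg 3))).
    by [].
  rewrite beval_NEq beval_BNe0 /= r3 fr.1 // r8 fr.2 //.
  by rewrite -g1 mxE.
move=> s2 f2 found; have g2 : vec n s2 7 = g by rewrite (vec_frame n f2).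
by exists e; rewrite g2; split=> //; rewrite f2.1.
Qed.

(** Each turn either shifts or replaces the candidate and loses at least one entry of its support,
    so the support size serves as fuel. *)
Lemma wp_circ c d s :
  has_input A s -> vec n s 11 = c -> circuit_candidate A c d (vec n s 7) ->
  wp L Circ (fun s' => elementary_vector A (vec n s' 7) /\
    circuit_candidate A c d (vec n s' 7)) s.
Proof.
move=> inp s11 cand.
pose I f s' := [/\ circuit_candidate A c d (vec n s' 7), circ_state c d s' &
  (#|supp (vec n s' 7)| <= f)%N].
apply: wp_seq; apply: wp_conseq (wp_circ_test inp s11 cand) _.
move=> s0 f0 state0.
have {}inp := has_input_frame f0 isT isT isT inp.
rewrite -(vec_frame n f0 (a := 7)) // in cand.
rewrite -(vec_frame n f0 (a := 11)) // in s11.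
have card_le g : (#|supp g : {set 'I_n}| <= n)%N.
  by rewrite -[X in (_ <= X)%N]card_ord max_card.
apply: wp_conseq (wp_while (I := I) nL _ _) _.
- by split=> //; apply: card_le.
- move=> f s' fr [cand' [e [r8 ge found]] cardf].
  have {}fr : frame (wregs Circ) (warrs Circ) s0 s'.
    by apply: frame_sub fr; list_subset.
  move=> cs; have inp' := has_input_frame fr isT isT isT inp.
  have [m' n' A'] := inp'.
  have c' : vec n s' 11 = c by rewrite (vec_frame n fr).
  have g0 : vec n s' 7 != 0 by case: cand'.
  split; first exact: leq_trans (card_supp_gt0 g0) cardf.
  case: found => [[r7 _]|[p [r7 kv]]].
    by move: cs; rewrite /= n' r7 leqnn.
  apply: wp_seq; apply: wp_conseq (wp_signed inp' r7 kv) _.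
  move=> s1 f1 [[u0 Au uP] cu].
  set u := vec n s1 13 in u0 Au uP cu.
  set g := vec n s' 7 in cand' ge g0 uP cardf.
  have g1 : vec n s1 7 = g by rewrite (vec_frame n f1).
  have inp1 := has_input_frame f1 isT isT isT inp'.
  have [m1 n1 A1] := inp1.
  have c1 : vec n s1 11 = c by rewrite (vec_frame n f1).
  rewrite c' in cu.
  apply: wp_seq; apply: wp_conseq.
    apply: (wp_find (n := n) (P := fun i => u i 0 * g i 0 < 0)
      (val := fun i => - (g i 0 / u i 0))) => //.
      by move=> i s2 f2 r3; rewrite beval_BLt /= r3 !f2.2 // -g1 !mxE.
    by move=> i s2 x f2 xE /=; rewrite xE !f2.2 // sub0r -g1 !mxE.
  move=> s2 f2 blocking.
  have u2 : vec n s2 13 = u by rewrite (vec_frame n f2).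
  have g2 : vec n s2 7 = g by rewrite (vec_frame n f2).
  have inp2 := has_input_frame f2 isT isT isT inp1.
  have [m2 n2 A2] := inp2.
  have c2 : vec n s2 11 = c by rewrite (vec_frame n f2).
  have reduced : wp L (If (BFound 9)
      (Seq (RSet 15 (NConst 0) (NConst 0)
              (RSub RZero (RDiv (rv 7 (NReg 9)) (rv 13 (NReg 9)))))
           (Assign 7 (RAdd (rv 7 (NReg 3))
              (RMul (rv 15 (NConst 0)) (rv 13 (NReg 3))))))
      (Assign 7 (rv 13 (NReg 3)))) (fun s3 =>
        circuit_candidate A c d (vec n s3 7) /\
        (#|supp (vec n s3 7)| < #|supp g|)%N) s2.
    apply: wp_if => [found|].
      case: blocking => [[r9 _]|[q [r9 ug min _]]].
        by move: found; rewrite /= n2 r9 leqnn.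
      have [candS cardS] := candidate_shift cand' Au cu uP ge ug min.
      apply: wp_seq; apply: wp_rset.
      apply: wp_conseq.
        apply: (wp_assign nL L1
          (F := fun i => g i 0 + - (g q 0 / u q 0) * u i 0)).
          by [].
        move=> i s4 f4 r3 /= r7i; rewrite r3 r7i /=.
        by rewrite !f4.2 //= r9 sub0r -g2 -u2 !mxE.
      move=> s4 _ ->.
      rewrite (_ : \col_i _ = g + (- (g q 0 / u q 0)) *: u) //.
      by apply/colP => i; rewrite !mxE.
    move=> found; case: blocking => [[r9 none]|[q [r9 _ _ _]]]; last first.
      by move: found; rewrite /= n2 r9 -ltnNge ltn_ord.
    apply: wp_conseq.
      apply: (wp_assign nL L1 (F := fun i => u i 0)); first by [].
      by move=> i s4 f4 r3 _ /=; rewrite r3 f4.2 // -u2 mxE.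
    move=> s4 _ ->.
    rewrite (_ : \col_i _ = u); last by apply/colP => i; rewrite mxE.
    by apply: (candidate_replace cand' Au u0 cu uP ge) => i; rewrite leNgt none.
  apply: wp_seq; apply: wp_conseq reduced _ => s3 f3 [cand3 card3].
  apply: wp_conseq.
    apply: (wp_circ_test (c := c) (d := d) _ _ cand3).
      exact: has_input_frame f3 _ _ _ inp2.
    by rewrite (vec_frame n f3).
  move=> s4 f4 state4; split=> //; rewrite (vec_frame n f4) //.
  by rewrite -ltnS (leq_trans card3) // (leq_trans cardf) // leqSpred.
- move=> s' fr [cs [f [cand' [e [r8 ge found]] _]]]; split=> //.
  have [_ n' _] := has_input_frame fr isT isT isT inp.
  case: found => [[_ triv]|[p [r7 _]]].
    by case: cand' => Ag _ _ _; apply: elementary_of_trivial_kernel ge triv.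
  by move: cs; rewrite /= n' r7 negbK leqNgt ltn_ord.
Qed.

Variables (b : 'cV[R]_m) (x0 : 'cV[R]_n).

Definition walk_state s : Prop :=
  circuit_walk A b x0 (vec n s 2) (nreg s 2) (output_walk n s).

Lemma wp_record s :
  nreg s 1 = n ->
  wp L Record (fun s' => output_walk n s' (nreg s 2) = vec n s 2 /\
    forall i, i != nreg s 2 -> output_walk n s' i = output_walk n s i) s.
Proof.
move=> s1.
pose I k s' := forall i (j : 'I_n), rarr s' 4 i j =
  if (i == nreg s 2) && (j < k)%N then rarr s 2 j 0 else rarr s 4 i j.
apply: wp_conseq (wp_for (I := I) nL _ _ _ _) _ => //.
- by move=> s' fr /=; rewrite fr.1.
- by move=> i j; rewrite andbF.
- move=> k s' kn fr r4 Ik; apply: wp_rset => i j /=.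
  rewrite r4 Ik !fr.1 // !fr.2 //= ltnS (leq_eqVlt j).
  have [->|] //= := eqVneq i (nreg s 2).
  by have [->|] := eqVneq (j : nat) k.
- move=> s' fr IN; split.
    by apply/colP => j; rewrite !mxE IN eqxx ltn_ord.
  by move=> i /negPf ik; apply/colP => j; rewrite !mxE IN ik.
Qed.

Lemma wp_step s (g := vec n s 7) :
  has_input A s -> walk_state s -> elementary_vector A g ->
  (exists i, g i 0 < 0) -> (forall i, g i 0 < 0 -> 0 < vec n s 2 i 0) ->
  wp L Step (fun s' => [/\ walk_state s', nreg s' 2 = (nreg s 2).+1 &
    exists a q, [/\ 0 <= a, g q 0 < 0, vec n s' 2 = vec n s 2 + a *: g &
      vec n s' 2 q 0 = 0]]) s.
Proof.
move=> inp walk elg [i gi] pos; have [mE nE AE] := inp.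
have xP : in_polyhedron A b (vec n s 2).
  by have [_ <- wP _] := walk; apply: wP.
have Ag : A *m g = 0 by case: elg.
set x := vec n s 2 in xP pos *.
apply: wp_seq; apply: wp_conseq.
  apply: (wp_find (n := n) (P := fun i => g i 0 < 0)
    (val := fun i => x i 0 / (0 - g i 0))) => //.
    by move=> k s' fr r3; rewrite beval_BLt /= r3 fr.2 // /g mxE.
  by move=> k s' e fr eE /=; rewrite eE !fr.2 // /g /x !mxE.
move=> s1 f1 [[_ none]|[q [r9 gq min _]]]; first by have := none i; rewrite gi.
have [a0 yP yq max] := maximal_step xP Ag pos gq min.
set a := x q 0 / (0 - g q 0) in a0 yP yq max.
apply: wp_seq; apply: wp_rset.
apply: wp_seq; apply: wp_conseq.
  apply: (wp_assign nL L1 (F := fun i => (x + a *: g) i 0)) => /=.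
    by rewrite f1.1.
  move=> k s2 f2 r3 /= r2; rewrite r3 r2 !f2.2 //= r9.
  by rewrite !f1.2 // /a !mxE.
move=> s2 f2 x2.
have {}x2 : vec n s2 2 = x + a *: g by rewrite x2; apply/colP => k; rewrite mxE.
apply: wp_seq; apply: wp_nset.
have k2 : nreg s2 2 = nreg s 2 by rewrite f2.1 //= f1.1.
have w2 i' : output_walk n s2 i' = output_walk n s i'.
  by apply/colP => k; rewrite !mxE f2.2 //= f1.2.
apply: wp_conseq.
  apply: wp_record => /=.
  by rewrite f2.1 //= f1.1.
move=> s3 f3 [wk wi]; rewrite /= k2 addn1 in wk wi.
have k3 : nreg s3 2 = (nreg s 2).+1 by rewrite f3.1 //= k2 addn1.
have x3 : vec n s3 2 = x + a *: g.
  by rewrite -x2; apply/colP => k; rewrite !mxE f3.2.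
split=> //.
  rewrite /walk_state x3 k3.
  apply: circuit_walk_rcons walk _ _ elg a0 yP max => [j jk|].
    rewrite wi ?ltn_eqF ?ltnS //; first exact: w2.
  by rewrite wk -x2; apply/colP => k; rewrite !mxE.
by exists a, q; rewrite x3 ltW.
Qed.

End CircuitRoutine.

(** * The two stages of the walk *)

Definition SuppTest := Ker (BNe0 (rv 2 (NReg 3))).

(** With every cost equal to [-1], the circuit has a nonpositive sum of entries; being nonzero, it
    has a negative entry, so the step is blocked. The circuit lies in the support of the current
    point, so each step removes a support element and adds none. *)
Definition Descend :=
  Seq SuppTest
  (While (BFound 7)
    (Seq (Assign 11 (RSub RZero ROne))
    (Seq Signed
    (Seq (Assign 7 (rv 13 (NReg 3)))
    (Seq Circ
    (Seq Step SuppTest)))))).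

Definition Kconst := rv 14 (NConst 0).
Definition Kv e := RMul (RAdd Kconst Kconst) (rv 3 e).
Definition Kinv6 :=
  let e := RDiv ROne Kconst in RMul e (RMul e (RMul e (RMul e (RMul e e)))).
Definition IsBig a := BLt (Kv (NReg 3)) (rv a (NReg 3)).

Definition NextBig := Find 10 (IsBig 2) no_val.

(** A large coordinate that has dropped to at most [x0 i / K^6] calls for the direction that ends
    the phase; otherwise a geometric step is prepared for the coordinate in register 10. *)
Definition Direction :=
  Seq (Find 11 (BAnd (IsBig 2)
         (BRLe (rv 2 (NReg 3)) (RMul Kinv6 (rv 5 (NReg 3))))) no_val)
  (Seq (If (BFound 11)
          (Assign 7 (RAdd (RSub (rv 3 (NReg 3)) (rv 5 (NReg 3)))
             (RMul (RMul (RAdd (RAdd ROne ROne) (RAdd ROne ROne)) Kconst)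
                (RSub (rv 3 (NReg 3)) (rv 2 (NReg 3))))))
          (Seq (NSet 11 (NReg 10))
               (Assign 7 (RSub (rv 3 (NReg 3)) (rv 2 (NReg 3))))))
       (VMap 11 (NEq (NReg 3) (NReg 11))
          (RSub (RDiv Kconst (rv 7 (NReg 3))) (RDiv ROne (rv 7 (NReg 3))))
          (RSub RZero (RDiv ROne (rv 7 (NReg 3)))))).

(** A coordinate that was large at the start of the phase and is no longer large ends the phase; the
    current point starts the next one. *)
Definition Restart :=
  Seq (Find 11 (BAnd (IsBig 5) (BNot (IsBig 2))) no_val)
      (If (BFound 11) (Assign 5 (rv 2 (NReg 3))) Skip).

(* Array 5 holds the start of the phase and array 14 the number K = 2m; register
   10 is the first large coordinate, and register 11 the one at which the
   circuit is to have a large relative entry. *)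
Definition Approach :=
  Seq (Assign 5 (rv 2 (NReg 3)))
  (Seq NextBig
  (While (BFound 10)
    (Seq Direction
    (Seq Circ
    (Seq Step
    (Seq Restart NextBig)))))).

(** Either direction is negative at a coordinate that is large in both [x] and [x0]; a circuit with
    a positive relative entry there then has a negative entry. *)
Lemma excess_direction (R : realFieldType) (K v x x0 : R) :
  4 <= K -> 0 <= v -> (K + K) * v < x -> (K + K) * v < x0 ->
  v < x /\ v - x0 + 4 * K * (v - x) < 0.
Proof.
move=> K4 v0 xK x0K.
have Kv : 4 * v <= K * v by rewrite ler_wpM2r.
have vx : v < x by lra.
split=> //; have : 0 < K * (x - v) by rewrite mulr_gt0 ?subr_gt0 //; lra.
by move=> ?; lra.
Qed.

Section Phases.
Variables (R : realFieldType) (m n L : nat) (A : 'M[R]_(m, n)).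
Variables (b : 'cV[R]_m) (xi v : 'cV[R]_n).
Hypotheses (mL : (m <= L)%N) (nL : (n <= L)%N) (L1 : (1 <= L)%N).
Implicit Types (s : store R) (P : pred 'I_n).

Lemma walk_state_in_polyhedron s :
  walk_state A b xi s -> in_polyhedron A b (vec n s 2).
Proof. by move=> [_ <- wP _]; apply: wP. Qed.

Lemma walk_state_frame rs arrs s s' :
  frame rs arrs s s' -> 2%N \notin rs -> 2%N \notin arrs -> 4%N \notin arrs ->
  walk_state A b xi s -> walk_state A b xi s'.
Proof.
move=> fr r2 a2 a4; rewrite /walk_state fr.1 // (vec_frame n fr) //.
move=> [w0 wk wP step].
have wE i : output_walk n s' i = output_walk n s i.
  by apply/colP => j; rewrite !mxE fr.2.
split; rewrite ?wE // => i ik; rewrite ?wE; first exact: wP.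
exact: step.
Qed.

Lemma wp_supp_test s (x := vec n s 2) :
  has_input A s ->
  wp L SuppTest (kernel_found A (fun i => x i 0 != 0)) s.
Proof.
move=> inp; apply: (wp_ker mL nL L1 inp) => i s' fr r3.
by rewrite beval_BNe0 /= r3 fr.2 // /x mxE.
Qed.

Lemma wp_descend s :
  has_input A s -> walk_state A b xi s -> nreg s 2 = 0%N ->
  wp L Descend (fun s' => [/\ walk_state A b xi s', (nreg s' 2 <= n)%N &
    independent A (supp (vec n s' 2))]) s.
Proof.
move=> inp walk k0.
(* The fuel [f] bounds the support; each step lowers it by one, so that the walk length plus [f]
   never exceeds [n]. *)
pose I f s' := [/\ walk_state A b xi s',
  kernel_found A (fun i => vec n s' 2 i 0 != 0) s',
  (#|supp (vec n s' 2)| <= f)%N & (nreg s' 2 + f <= n)%N].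
apply: wp_seq; apply: wp_conseq (wp_supp_test inp) _ => s0 f0 found0.
rewrite -(vec_frame n f0 (a := 2)) // in found0.
have {}inp := has_input_frame f0 isT isT isT inp.
have {}walk := walk_state_frame f0 isT isT isT walk.
apply: wp_conseq (wp_while (I := I) nL _ _) _.
- split=> //; last by rewrite f0.1 // k0.
  by rewrite -[X in (_ <= X)%N]card_ord max_card.
- move=> f s' fr [walk' found cardf kf] cs.
  have inp' := has_input_frame fr isT isT isT inp.
  have [m' n' A'] := inp'.
  case: found => [[r7 _]|[p [r7 kv]]].
    by move: cs; rewrite /= n' r7 leqnn.
  set x := vec n s' 2 in kv cardf.
  have x0 : (0 < #|supp x|)%N.
    have [u0 _ uP] := kv; apply: card_supp_gt0; apply: contraNneq u0 => x0.
    by apply/eqP/colP => i; rewrite [RHS]mxE uP // x0 mxE eqxx.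
  split; first exact: leq_trans x0 cardf.
  apply: wp_seq; apply: wp_conseq.
    by apply: (wp_assign nL L1 (F := fun _ => -1)) => // *; rewrite /= sub0r.
  move=> s1 f1 c1.
  have inp1 := has_input_frame f1 isT isT isT inp'.
  have col1 : (\col_i rarr s1 8 i p) = \col_(i < n) rarr s' 8 i p.
    by apply/colP => i; rewrite !mxE f1.2.
  rewrite -col1 in kv.
  have r71 : nreg s1 7 = p by rewrite f1.1.
  apply: wp_seq; apply: wp_conseq (wp_signed nL L1 inp1 r71 kv) _.
  move=> s2 f2 [[u0 Au uP] cu]; set u := vec n s2 13 in u0 Au uP cu.
  apply: wp_seq; apply: wp_conseq.
    apply: (wp_assign nL L1 (F := fun i => u i 0)).
      by rewrite f2.1 // f1.1.
    by move=> i s3 f3 r3 _; rewrite /= r3 f3.2 // /u mxE.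
  move=> s3 f3 u3.
  have {}u3 : vec n s3 7 = u by rewrite u3; apply/colP => i; rewrite mxE.
  have inp3 := has_input_frame f3 isT isT isT
    (has_input_frame f2 isT isT isT inp1).
  have c3 : vec n s3 11 = vec n s1 11.
    by rewrite (vec_frame n f3) // (vec_frame n f2).
  have cand : circuit_candidate A (vec n s1 11) u (vec n s3 7).
    by rewrite u3; split=> //; apply: conformal_refl.
  apply: wp_seq; apply: wp_conseq (wp_circ mL nL L1 inp3 c3 cand) _.
  move=> s4 f4 [elg [Ag g0 ug cg]]; set g := vec n s4 7 in elg Ag g0 ug cg.
  have x4 : vec n s4 2 = x.
    by rewrite (vec_frame n f4) // (vec_frame n f3) // (vec_frame n f2) //
      (vec_frame n f1).
  have walk4 := walk_state_frame f4 isT isT isT (walk_state_frame f3 isT isT isT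
    (walk_state_frame f2 isT isT isT (walk_state_frame f1 isT isT isT walk'))).
  have inp4 := has_input_frame f4 isT isT isT inp3.
  have gx i : x i 0 = 0 -> g i 0 = 0.
    by move=> xi0; apply: (ug i).1; apply: uP; rewrite negbK xi0.
  have [_ xge0] := walk_state_in_polyhedron walk4; rewrite x4 in xge0.
  have gneg : exists i, g i 0 < 0.
    apply/existsP; apply: contraT; rewrite negb_exists => /forallP pos.
    have {}pos i : 0 <= g i 0 by rewrite leNgt.
    case/eqP: g0; apply/colP => i; rewrite [RHS]mxE.
    move: cg; rewrite c1 /dot (eq_bigr (fun i => - g i 0)); last first.
      by move=> j _; rewrite mxE mulN1r.
    rewrite sumrN oppr_ge0 => le0.
    have /eqP : \sum_j g j 0 = 0.
      by apply/eqP; rewrite eq_le le0 sumr_ge0.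
    rewrite psumr_eq0 => [/allP/(_ i)|//].
    by rewrite mem_index_enum => /(_ isT)/eqP.
  have gpos i : g i 0 < 0 -> 0 < vec n s4 2 i 0.
    move=> gi; rewrite x4 lt_def xge0 andbT; apply: contraTneq gi => /gx ->.
    by rewrite ltxx.
  apply: wp_seq; apply: wp_conseq (wp_step nL L1 inp4 walk4 elg gneg gpos) _.
  rewrite x4 => s5 f5 [walk5 k5 [a [q [a0 gq x5 yq]]]].
  have card5 : (#|supp (vec n s5 2)| < #|supp x|)%N.
    apply: proper_card; apply/properP; split.
      apply/subsetP => i; rewrite x5 !inE; apply: contraNneq => xi0.
      by rewrite mxE [(a *: g) i 0]mxE xi0 gx // mulr0 addr0.
    exists q; last by rewrite inE yq eqxx.
    by rewrite inE; apply: contraTneq gq => /gx ->; rewrite ltxx.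
  have inp5 := has_input_frame f5 isT isT isT inp4.
  apply: wp_conseq (wp_supp_test inp5) _ => s6 f6 found6.
  have x6 : vec n s6 2 = vec n s5 2 by rewrite (vec_frame n f6).
  have f_gt0 : (0 < f)%N by apply: leq_trans x0 cardf.
  split; rewrite ?x6 //.
  + exact: walk_state_frame f6 _ _ _ walk5.
  + by rewrite -ltnS (leq_trans card5) // (leq_trans cardf) // leqSpred.
  + rewrite f6.1 // k5 f4.1 // f3.1 // f2.1 // f1.1 //.
    by rewrite addSnnS prednK.
- move=> s' fr [cs [f [walk' found _ kf]]].
  have [_ n' _] := has_input_frame fr isT isT isT inp.
  split=> //; first exact: leq_trans (leq_addr _ _) kf.
  case: found => [[_ triv] z zS|[p [r7 _]]].
    by apply: triv => i xi0; apply: zS; rewrite inE.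
  by move: cs; rewrite /= n' r7 negbK leqNgt ltn_ord.
Qed.

(** [T] bounds the number of geometric steps in a phase and [F] the length of the whole walk; [S]
    contains the supports of [v] and of all points of the second stage. *)
Variables (K : R) (T F : nat) (S : {set 'I_n}).
Hypotheses (K4 : 4 <= K) (FL : (F <= L)%N) (SK : #|S|%:R <= K).
Hypotheses (vP : in_polyhedron A b v) (vS : forall i, i \notin S -> v i 0 = 0).
Hypothesis vind : independent A (supp v).
Hypothesis decay : forall a,
  K^-1 ^+ 6 < (1 - (K + K)^-1) ^+ a -> (a < T)%N.

Definition consts s : Prop := rarr s 14 0 0 = K /\ vec n s 3 = v.

Lemma consts_frame rs arrs s s' :
  frame rs arrs s s' -> 14%N \notin arrs -> 3%N \notin arrs ->
  consts s -> consts s'.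
Proof.
by move=> fr a14 a3 [sK sv]; split; [rewrite fr.2|rewrite (vec_frame n fr)].
Qed.

Lemma beval_IsBig s a (i : 'I_n) :
  consts s -> nreg s 3 = i ->
  beval s (IsBig a) = (i \in excess_set v K (vec n s a)).
Proof.
move=> [sK sv] r3; rewrite beval_BLt inE /= r3 sK -sv.
by rewrite !mxE.
Qed.

Lemma reval_Kinv6 s : consts s -> reval s Kinv6 = K^-1 ^+ 6.
Proof. by move=> [sK _]; rewrite /= sK !div1r !exprS expr0 mulr1. Qed.

(** The set of large coordinates is constant within a phase, so always choosing its first element
    fixes one coordinate for the phase, and the factors of the geometric steps multiply. *)
Definition first_in (U : {set 'I_n}) (i0 : 'I_n) : Prop :=
  i0 \in U /\ forall i : 'I_n, (i < i0)%N -> i \notin U.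

Lemma first_in_inj U i j : first_in U i -> first_in U j -> i = j.
Proof.
move=> [iU fi] [jU fj]; apply: val_inj => /=; case: (ltngtP i j) => // ij.
  by have := fj _ ij; rewrite iU.
by have := fi _ ij; rewrite jU.
Qed.

Definition big_found s : Prop :=
  let U := excess_set v K (vec n s 2) in
  (nreg s 10 = n /\ U = set0) \/
  exists i0 : 'I_n, nreg s 10 = i0 /\ first_in U i0.

Lemma wp_next_big s :
  nreg s 1 = n -> consts s -> wp L NextBig big_found s.
Proof.
move=> s1 cst; set U := excess_set v K (vec n s 2).
apply: wp_conseq.
  apply: (wp_find (n := n) (P := fun i => i \in U) (val := fun _ => 0)) => //.
  move=> i s' fr r3; rewrite (beval_IsBig _ (consts_frame fr isT isT cst) r3).
  by rewrite (vec_frame n fr).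
move=> s' fr; rewrite /big_found (vec_frame n fr) // -/U.
move=> [[r10 none]|[q [r10 qU _ fst]]]; [left|right].
  by split=> //; apply/setP => i; rewrite in_set0; exact/negbTE/none.
exists q; split=> //; split=> // i iq; apply: contraTN isT => iU.
by have := fst i iU iq; rewrite ltxx.
Qed.

Definition good_direction (x x0 d : 'cV[R]_n) (i0 i2 : 'I_n) : Prop :=
  (x i2 0 <= K^-1 ^+ 6 * x0 i2 0 /\ d = (v - x0) + (4 * K) *: (v - x)) \/
  [/\ K^-1 ^+ 6 * x0 i2 0 < x i2 0, i2 = i0 & d = v - x].

Lemma wp_direction s (i0 : 'I_n) (x := vec n s 2) (x0 := vec n s 5) :
  nreg s 1 = n -> consts s -> nreg s 10 = i0 -> i0 \in excess_set v K x ->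
  wp L Direction (fun s' => exists i2,
    [/\ i2 \in excess_set v K x, vec n s' 11 = ratio_cost K (vec n s' 7) i2 &
        good_direction x x0 (vec n s' 7) i0 i2]) s.
Proof.
move=> s1 cst r10 i0U.
set U := excess_set v K x in i0U *.
apply: wp_seq; apply: wp_conseq.
  apply: (wp_find (n := n) (val := fun _ => 0)
    (P := fun i => (i \in U) && (x i 0 <= K^-1 ^+ 6 * x0 i 0))) => //.
  move=> i s' fr r3; have cst' := consts_frame fr isT isT cst.
  have -> : beval s' (BAnd (IsBig 2) (BRLe (rv 2 (NReg 3))
      (RMul Kinv6 (rv 5 (NReg 3))))) = beval s' (IsBig 2) &&
      (rarr s' 2 (nreg s' 3) 0 <= reval s' Kinv6 * rarr s' 5 (nreg s' 3) 0).
    by [].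
  rewrite (beval_IsBig _ cst' r3) (reval_Kinv6 cst') (vec_frame n fr) //.
  by rewrite r3 !fr.2 // /x /x0 !mxE.
move=> s2 f2 small.
have cst2 := consts_frame f2 isT isT cst.
have n2 : nreg s2 1 = n by rewrite f2.1.
apply: wp_seq; apply: (wp_conseq (Q := fun s3 => exists i2 : 'I_n,
    [/\ nreg s3 11 = i2, i2 \in U & good_direction x x0 (vec n s3 7) i0 i2])).
  apply: wp_if => found.
    case: small => [[r11 _]|[q [r11 /andP[qU small] _ _]]].
      by move: found; rewrite /= n2 r11 leqnn.
    apply: wp_conseq.
      apply: (wp_assign nL L1
        (F := fun i => ((v - x0) + (4 * K) *: (v - x)) i 0)) => //.
      move=> i s3 f3 r3 _ /=; have [cK cv] := consts_frame f3 isT isT cst2.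
      rewrite r3 cK -cv !mxE !(f3.2 _ _ _ _) // !(f2.2 2%N) // !(f2.2 5%N) //.
      by congr (_ + _ * _ * _); ring.
    move=> s3 f3 dE; exists q; rewrite f3.1 // dE; split=> //; left; split=> //.
    by apply/colP => i; rewrite mxE.
  case: small => [[r11 none]|[q [r11 _ _ _]]]; last first.
    by move: found; rewrite /= n2 r11 -ltnNge ltn_ord.
  apply: wp_seq; apply: wp_nset; apply: wp_conseq.
    apply: (wp_assign nL L1 (F := fun i => (v - x) i 0)) => //=.
    move=> i s3 f3 r3 _ /=; have [cK cv] := consts_frame f3 isT isT cst2.
    by rewrite r3 -cv !mxE !f3.2 // !(f2.2 2%N).
  move=> s3 f3 dE; exists i0; rewrite f3.1 //= f2.1 // dE; split=> //.
  right; split=> //; last by apply/colP => i; rewrite mxE.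
  by have := none i0; rewrite i0U /= -ltNge.
move=> s3 f3 [i2 [r11 i2U dir]].
apply: wp_conseq.
  apply: (wp_vmap nL L1 (F := fun i => ratio_cost K (vec n s3 7) i2 i 0)).
    by rewrite f3.1.
  move=> i s4 f4 r3 _.
  have [cK _] := consts_frame f4 isT isT (consts_frame f3 isT isT cst2).
  rewrite beval_NEq /= r3 f4.1 // r11 cK !f4.2 // !mxE -val_eqE.
  by case: eqP => _ /=; rewrite ?sub0r.
move=> s4 f4 cE; exists i2; rewrite (vec_frame n f4 (a := 7)) //; split=> //.
by rewrite cE; apply/colP => i; rewrite mxE.
Qed.

(** Here [a] counts the geometric steps of the current phase. Every large coordinate is charged
    [T.+1] steps, for at most [T] geometric ones and one that ends the phase; steps already made in
    the phase are credited by [a]. *)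
Definition approach_state f s : Prop :=
  let x := vec n s 2 in let x0 := vec n s 5 in let U := excess_set v K x in
  [/\ walk_state A b xi s, in_polyhedron A b x0,
      forall i, i \notin S -> x i 0 = 0 /\ x0 i 0 = 0,
      U = excess_set v K x0 &
      exists2 a : nat, (a <= T)%N /\ (nreg s 2 + #|U| * T.+1 <= F + a)%N &
        (nreg s 2 + f = F)%N /\ forall i0, first_in U i0 ->
          x i0 0 <= (1 - (K + K)^-1) ^+ a * x0 i0 0].

Lemma approach_state_frame rs arrs f s s' :
  frame rs arrs s s' -> 2%N \notin rs -> 2%N \notin arrs -> 4%N \notin arrs ->
  5%N \notin arrs -> approach_state f s -> approach_state f s'.
Proof.
move=> fr r2 a2 a4 a5 [walk x0P xS UU count]; split.
- exact: walk_state_frame fr _ _ _ walk.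
- by rewrite (vec_frame n fr).
- by rewrite !(vec_frame n fr).
- by rewrite !(vec_frame n fr).
- by rewrite !(vec_frame n fr) // fr.1.
Qed.

(* The two outcomes of a step: the set of large coordinates shrinks, which
   starts a new phase, or it stays the same and one more geometric step of the
   phase has been made. *)
Lemma wp_restart f a s (x := vec n s 2) (x0 := vec n s 5)
    (U := excess_set v K x) (U0 := excess_set v K x0) :
  nreg s 1 = n -> consts s -> walk_state A b xi s -> in_polyhedron A b x0 ->
  (forall i, i \notin S -> x i 0 = 0 /\ x0 i 0 = 0) ->
  U \subset U0 -> (a <= T)%N -> (nreg s 2 + #|U0| * T.+1 <= F + a.+1)%N ->
  (nreg s 2 + f = F)%N ->
  (U = U0 -> (a < T)%N /\ forall i0, first_in U i0 ->
          x i0 0 <= (1 - (K + K)^-1) ^+ a.+1 * x0 i0 0) ->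
  wp L Restart (approach_state f) s.
Proof.
move=> s1 cst walk x0P xS UU aT count kf same.
apply: wp_seq; apply: wp_conseq.
  apply: (wp_find (n := n) (val := fun _ => 0)
    (P := fun i => (i \in U0) && (i \notin U))) => //.
  move=> i s' fr r3; have cst' := consts_frame fr isT isT cst.
  have -> : beval s' (BAnd (IsBig 5) (BNot (IsBig 2))) =
      beval s' (IsBig 5) && ~~ beval s' (IsBig 2) by [].
  by rewrite !(beval_IsBig _ cst' r3) !(vec_frame n fr).
move=> s2 f2 event; have n2 : nreg s2 1 = n by rewrite f2.1.
have walk2 := walk_state_frame f2 isT isT isT walk.
have x2 : vec n s2 2 = x by rewrite (vec_frame n f2).
have x02 : vec n s2 5 = x0 by rewrite (vec_frame n f2).
apply: wp_if => found.
  have UltU0 : (#|U| < #|U0|)%N.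
    case: event => [[r11 _]|[q [_ /andP[qU0 qU] _ _]]].
      by move: found; rewrite /= n2 r11 leqnn.
    by apply: proper_card; apply/properP; split=> //; exists q.
  apply: wp_conseq.
    apply: (wp_assign nL L1 (F := fun i => x i 0)) => //.
    by move=> i s3 f3 r3 _; rewrite /= r3 f3.2 // -x2 mxE.
  move=> s3 f3 x3.
  have {}x3 : vec n s3 5 = x by rewrite x3; apply/colP => i; rewrite mxE.
  have x3' : vec n s3 2 = x by rewrite (vec_frame n f3).
  have walk3 := walk_state_frame f3 isT isT isT walk2.
  rewrite /approach_state x3 x3'; split=> //.
  - by have := walk_state_in_polyhedron walk3; rewrite x3'.
  - by move=> i /xS[].
  exists 0%N; rewrite f3.1 // f2.1 //; last first.
    by split=> // i0 _; rewrite expr0 mul1r.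
  (* Losing a large coordinate releases [T.+1] steps, enough to pay for the credit [a.+1] since
     [a <= T]. *)
  split=> //; rewrite addn0 -(leq_add2r a.+1); apply: leq_trans count.
  rewrite -addnA leq_add2l.
  apply: leq_trans (_ : #|U|.+1 * T.+1 <= _)%N; last first.
    by rewrite leq_mul2r UltU0 orbT.
  by rewrite mulSn addnC leq_add2r ltnS.
apply: wp_skip; rewrite /approach_state x2 x02 f2.1 // -/U -/U0.
have UE : U = U0.
  apply/eqP; rewrite eqEsubset UU; apply/subsetP => i iU0.
  case: event => [[_ none]|[q [r11 _ _ _]]].
    by have := none i; rewrite iU0 negbK.
  by move: found; rewrite /= n2 r11 -ltnNge ltn_ord.
have [aT' shrink] := same UE; split=> //.
by exists a.+1 => //; split=> //; rewrite UE.
Qed.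

Lemma wp_approach s :
  has_input A s -> consts s -> walk_state A b xi s ->
  (forall i, i \notin S -> vec n s 2 i 0 = 0) ->
  (nreg s 2 + #|excess_set v K (vec n s 2)| * T.+1 <= F)%N ->
  wp L Approach (fun s' =>
    circuit_walk A b xi v (nreg s' 2) (output_walk n s') /\
    (nreg s' 2 <= F)%N) s.
Proof.
move=> inp cst walk xS count; have [_ n0 _] := inp.
have xP := walk_state_in_polyhedron walk.
set x := vec n s 2 in xS count xP.
apply: wp_seq; apply: wp_conseq.
  apply: (wp_assign nL L1 (F := fun i => x i 0)) => //.
  by move=> i s' fr r3 _; rewrite /= r3 fr.2 // mxE.
move=> s1 f1 x01.
have {}x01 : vec n s1 5 = x by rewrite x01; apply/colP => i; rewrite mxE.
have x1 : vec n s1 2 = x by rewrite (vec_frame n f1).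
have inp1 := has_input_frame f1 isT isT isT inp.
have cst1 := consts_frame f1 isT isT cst.
have walk1 := walk_state_frame f1 isT isT isT walk.
have kF : (nreg s1 2 <= F)%N.
  by rewrite f1.1 //; apply: leq_trans (leq_addr _ _) count.
have app1 : approach_state (F - nreg s1 2) s1.
  rewrite /approach_state x01 x1; split=> //; first by move=> i /xS.
  exists 0%N; first by rewrite f1.1 // addn0.
  by rewrite subnKC //; split=> // i0 _; rewrite expr0 mul1r.
have [_ n1 _] := inp1.
apply: wp_seq; apply: wp_conseq (wp_next_big n1 cst1) _ => s2 f2 found2.
have {}app1 := approach_state_frame f2 isT isT isT isT app1.
have inp2 := has_input_frame f2 isT isT isT inp1.
have cst2 := consts_frame f2 isT isT cst1.
pose I f s' := approach_state f s' /\ big_found s'.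
have fL : (F - nreg s1 2 <= L)%N by apply: leq_trans FL; apply: leq_subr.
apply: wp_conseq (wp_while (I := I) fL _ _) _ => //; last first.
  move=> s' fr [cs [f [[walk' x0P xS' UU [a [aT count'] [kf _]]] found]]].
  have [_ n' _] := has_input_frame fr isT isT isT inp2.
  split; last by rewrite -kf leq_addr.
  have vx : vec n s' 2 = v.
    apply: (eq_of_subset_supp vind vP (walk_state_in_polyhedron walk')).
    case: found => [[_ /setP U0] i vi|[i0 [r10 _]]]; last first.
      by move: cs; rewrite /= n' r10 negbK leqNgt ltn_ord.
    have [_ xge0] := walk_state_in_polyhedron walk'.
    have := U0 i; rewrite !inE vi mulr0 => /negbT; rewrite -leNgt => le0.
    by apply/eqP; rewrite eq_le le0 xge0.
  by move: walk'; rewrite /walk_state vx.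
move=> f s' fr [app found] cs.
have inp' := has_input_frame fr isT isT isT inp2.
have cst' := consts_frame fr isT isT cst2.
have [_ n' _] := inp'.
case: found => [[r10 _]|[i0 [r10 fst0]]].
  by move: cs; rewrite /= n' r10 leqnn.
have {walk xP x xS count x01 x1 walk1 kF app1 fL found2} := app.
move=> [walk' x0P xS UU [a [aT count] [kf shrink]]].
have [x xE] : {x | x = vec n s' 2} by exists (vec n s' 2).
have [x0 x0E] : {x0 | x0 = vec n s' 5} by exists (vec n s' 5).
rewrite -?xE -?x0E in x0P xS UU count shrink fst0.
set U := excess_set v K x in UU count shrink fst0.
have i0U : i0 \in U by case: fst0.
have i0U' : i0 \in excess_set v K (vec n s' 2) by rewrite -xE.
have xP : in_polyhedron A b x.
  by rewrite xE; apply: walk_state_in_polyhedron walk'.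
(* A large coordinate remains and [a <= T], so the count leaves room for one more step. *)
have kF : (nreg s' 2 < F)%N.
  have U1 : (1 <= #|U|)%N by rewrite card_gt0; apply/set0Pn; exists i0.
  have : (nreg s' 2 + T.+1 <= F + T)%N.
    apply: leq_trans (leq_trans count _); last by rewrite leq_add2l.
    by rewrite leq_add2l leq_pmull.
  by rewrite addnS -addSn leq_add2r.
have f0 : (0 < f)%N by rewrite -(ltn_add2l (nreg s' 2)) addn0 kf.
split=> //.
apply: wp_seq; apply: wp_conseq (wp_direction n' cst' r10 i0U') _.
rewrite -xE -x0E -/U => s3 f3 [i2 [i2U c3 dir]].
have [d d3] : {d | d = vec n s3 7} by exists (vec n s3 7).
rewrite -d3 in c3 dir.
have inp3 := has_input_frame f3 isT isT isT inp'.
have dS i : i \notin S -> d i 0 = 0.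
  move=> iS; have [xi0 x0i0] := xS i iS.
  by case: dir => [[_ ->]|[_ _ ->]]; rewrite !mxE vS // xi0 ?x0i0; ring.
have [_ xge0] := xP; have [_ x0ge0] := x0P.
have d2 : d i2 0 < 0.
  have v2 := vP.2 i2; have Kge := K4.
  have x2 : (K + K) * v i2 0 < x i2 0 by move: i2U; rewrite inE.
  have x02 : (K + K) * v i2 0 < x0 i2 0 by move: i2U; rewrite UU inE.
  have [xv dneg] := excess_direction Kge v2 x2 x02.
  by case: dir => [[_ ->]|[_ _ ->]]; rewrite !mxE // subr_lt0.
have Ad : A *m d = 0.
  have [Av _] := vP; have [Ax _] := xP; have [Ax0 _] := x0P.
  case: dir => [[_ ->]|[_ _ ->]]; last by rewrite mulmxBr Av Ax subrr.
  by rewrite mulmxDr -scalemxAr !mulmxBr Av Ax Ax0 !subrr scaler0 addr0.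
have cand3 : circuit_candidate A (ratio_cost K d i2) d (vec n s3 7).
  rewrite -d3; split=> //.
  - by apply: contraTneq d2 => ->; rewrite mxE ltxx.
  - exact: conformal_refl.
  - apply: ratio_cost_self; first by rewrite lt_eqF.
    apply: le_trans SK; rewrite ler_nat; apply/subset_leq_card/subsetP => i.
    by rewrite inE; apply: contraNT => /dS ->.
apply: wp_seq; apply: wp_conseq (wp_circ mL nL L1 inp3 c3 cand3) _.
move=> s4 f4 [elg cand]; set g := vec n s4 7 in elg cand.
have inp4 := has_input_frame f4 isT isT isT inp3.
have walk4 := walk_state_frame f4 isT isT isT
  (walk_state_frame f3 isT isT isT walk').
have x4 : vec n s4 2 = x by rewrite xE (vec_frame n f4) // (vec_frame n f3).
have x04 : vec n s4 5 = x0 by rewrite x0E (vec_frame n f4) // (vec_frame n f3).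
have K0 : 0 <= K by apply: le_trans K4.
have [r [r0 gr _ ri2]] := candidate_ratio K0 cand.
have gneg : exists i, g i 0 < 0.
  by exists i2; rewrite gr pmulr_rlt0.
have gpos i : g i 0 < 0 -> 0 < vec n s4 2 i 0.
  rewrite x4 => gi; case: dir => [[small dE]|[_ _ dE]].
    rewrite dE in cand; have [+ _] :=
      final_step 0 i K4 vP x0P xP UU i2U small cand.
    exact.
  move: gi; rewrite gr dE !mxE => gi; have ri := r0 i.
  have : v i 0 - x i 0 < 0.
    by rewrite ltNge; apply: contraTN gi => ?; rewrite -leNgt mulr_ge0.
  by rewrite subr_lt0; apply: le_lt_trans; apply: vP.2.
apply: wp_seq; apply: wp_conseq (wp_step nL L1 inp4 walk4 elg gneg gpos) _.
rewrite x4 => s5 f5 [walk5 k5 [al [q [al0 gq x5 yq]]]].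
have inp5 := has_input_frame f5 isT isT isT inp4.
have cst5 := consts_frame f5 isT isT
  (consts_frame f4 isT isT (consts_frame f3 isT isT cst')).
have x05 : vec n s5 5 = x0 by rewrite (vec_frame n f5).
have k5' : nreg s5 2 = (nreg s' 2).+1 by rewrite k5 f4.1 // f3.1.
have yP := walk_state_in_polyhedron walk5; rewrite x5 in yP yq.
have [_ n5 _] := inp5.
(* A final step shrinks the set strictly, so its second claim is vacuous. A geometric step is made
   only while [x i2] exceeds [x0 i2 / K^6], which by [decay] forces [a < T]. *)
have outcome : excess_set v K (x + al *: g) \subset U /\
    (excess_set v K (x + al *: g) = U -> (a < T)%N /\ forall i, first_in U i ->
       (x + al *: g) i 0 <= (1 - (K + K)^-1) ^+ a.+1 * x0 i 0).
  case: dir => [[small dE]|[large i2E dE]]; rewrite dE in cand.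
    have [_ /(_ al0 gq yP yq) UP] :=
      final_step al q K4 vP x0P xP UU i2U small cand.
    split; first exact: proper_sub.
    by move=> UE; move: UP; rewrite UE properxx.
  have [sub dec] := geometric_step K4 vP xP i2U cand al0 gq yP yq.
  split=> // _.
  have x02 : 0 < x0 i2 0.
    move: i2U; rewrite UU inE; apply: le_lt_trans.
    by rewrite mulr_ge0 ?addr_ge0 ?vP.2.
  have shr : x i2 0 <= (1 - (K + K)^-1) ^+ a * x0 i2 0.
    by apply: shrink; rewrite i2E.
  split.
    by apply: decay; rewrite -(ltr_pM2r x02); apply: lt_le_trans large shr.
  move=> i fsti; rewrite (first_in_inj fsti fst0) -i2E.
  apply: le_trans dec _; rewrite exprS -mulrA; apply: ler_wpM2l shr.
  rewrite subr_ge0 invf_le1; last first.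
    by rewrite addr_gt0 // (lt_le_trans _ K4).
  have K1 : 1 <= K by apply: le_trans K4; rewrite ler1n.
  by apply: le_trans K1 _; rewrite lerDl.
have [Usub Usame] := outcome.
apply: wp_seq; apply: wp_conseq.
  apply: (wp_restart (f := f.-1) (a := a) n5 cst5 walk5);
    rewrite ?x05 ?x5 -?UU //.
  - move=> i iS; have [xi0 x0i0] := xS i iS; split=> //.
    by rewrite mxE [(al *: g) i 0]mxE xi0 gr dS // !mulr0 addr0.
  - by rewrite k5' addSn addnS ltnS.
  - by rewrite k5' addSnnS prednK.
  - by move=> UE; have := Usame UE; rewrite UE.
move=> s6 f6 app6.
have cst6 := consts_frame f6 isT isT cst5.
have n6 : nreg s6 1 = n by rewrite f6.1.
apply: wp_conseq (wp_next_big n6 cst6) _ => s7 f7 found7; split=> //.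
exact: approach_state_frame f7 _ _ _ _ app6.
Qed.

End Phases.

(** * The length of the walk *)

(** Array 14 receives [K = 2m] as a sum of [m] terms [1 + 1], since registers cannot be read as real
    numbers. *)
Definition CircuitWalk :=
  Seq (Acc 14 (NConst 1) (NConst 1) (NReg 0) (RAdd ROne ROne))
  (Seq Record
  (Seq Descend
       Approach)).

(** After the first stage the current point and [v] have independent supports of at most [m]
    elements each. This gives [#|S| <= 2m = K] and at most [m] large coordinates, hence at most [m]
    phases of at most [T.+1] steps. *)
Lemma wp_circuit_walk (R : realFieldType) (m n T L : nat) (A : 'M[R]_(m, n))
    (b : 'cV[R]_m) (x v : 'cV[R]_n) (K := m%:R + m%:R : R) :
  (2 <= m)%N -> in_polyhedron A b x -> vertex A b v ->
  (m <= L)%N -> (n <= L)%N -> (n + m * T.+1 <= L)%N ->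
  (forall a, K^-1 ^+ 6 < (1 - (K + K)^-1) ^+ a -> (a < T)%N) ->
  wp L CircuitWalk (fun s =>
    circuit_walk A b x v (output_length s) (output_walk n s) /\
    (output_length s <= n + m * T.+1)%N) (input_store A b x v).
Proof.
move=> m2 xP vV mL nL FL decay.
have L1 : (1 <= L)%N by apply: leq_trans mL; apply: leq_trans m2.
set s0 := input_store A b x v.
have inp0 : has_input A s0 by [].
have x0 : vec n s0 2 = x.
  by apply/colP => i; rewrite mxE /= (array_of_mxE x i ord0).
have v0 : vec n s0 3 = v.
  by apply/colP => i; rewrite mxE /= (array_of_mxE v i ord0).
apply: wp_seq; apply: wp_conseq.
  apply: (wp_scalar_acc L1 (nt := m) (F := fun _ => 1 + 1)) => // s' fr.
  by rewrite /= fr.1.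
move=> s1 f1 K1.
have {}K1 : rarr s1 14 0 0 = K.
  by rewrite K1 sumr_const card_ord mulrnDl.
have inp1 := has_input_frame f1 isT isT isT inp0.
have [_ n1 _] := inp1.
apply: wp_seq; apply: wp_conseq (wp_record nL n1) _ => s2 f2 [w2 _].
have k2 : nreg s2 2 = 0%N by rewrite f2.1 // f1.1.
have x2 : vec n s2 2 = x by rewrite (vec_frame n f2) // (vec_frame n f1).
have walk2 : walk_state A b x s2.
  have w20 : output_walk n s2 0 = x.
    by rewrite -x0 -(vec_frame n f1) // -w2 f1.1.
  rewrite /walk_state k2 x2; split=> // i.
  by rewrite leqn0 => /eqP ->; rewrite w20.
have inp2 := has_input_frame f2 isT isT isT inp1.
apply: wp_seq.
apply: wp_conseq (wp_descend mL nL L1 inp2 walk2 k2) _ => s3 f3 [walk3 k3 ind3].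
have inp3 := has_input_frame f3 isT isT isT inp2.
have vind := vertex_independent vV.
pose S := supp (vec n s3 2) :|: supp v.
have K4 : 4 <= K by rewrite /K -natrD ler_nat (leq_add m2 m2).
have SK : #|S|%:R <= K.
  rewrite /K -natrD ler_nat.
  apply: leq_trans (leq_add (independent_card ind3) (independent_card vind)).
  by rewrite cardsU leq_subr.
have vP : in_polyhedron A b v by case: vV.
have vS i : i \notin S -> v i 0 = 0.
  by rewrite !inE negb_or !negbK => /andP[_ /eqP].
have xS i : i \notin S -> vec n s3 2 i 0 = 0.
  by rewrite in_setU negb_or => /andP[+ _]; rewrite inE negbK => /eqP.
have cst3 : consts v K s3.
  split; first by rewrite f3.2 // f2.2.
  by rewrite (vec_frame n f3) // (vec_frame n f2) // (vec_frame n f1).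
have count : (nreg s3 2 + #|excess_set v K (vec n s3 2)| * T.+1 <=
    n + m * T.+1)%N.
  rewrite leq_add // leq_mul2r; apply/orP; right.
  apply: leq_trans (independent_card ind3).
  apply/subset_leq_card/subsetP => i; rewrite !inE => lt.
  rewrite gt_eqF //; apply: le_lt_trans lt.
  by rewrite mulr_ge0 ?addr_ge0 ?ler0n // vP.2.
exact: (wp_approach mL nL L1 K4 FL SK vP vS vind decay inp3 cst3 walk3 xS count).
Qed.

(** * Counting the geometric steps of a phase *)

Section Logarithm.
Variable R : realType.

(** From [1 - y <= exp (- y)] follows [a < 12 K ln K = 24 m ln K], and [K = 2m <= m^2] gives
    [ln K <= 2 ln m]. *)
Lemma geometric_decay (m a : nat) (K := m%:R + m%:R : R) :
  (2 <= m)%N -> K^-1 ^+ 6 < (1 - (K + K)^-1) ^+ a ->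
  a%:R < 48 * m%:R * ln (m%:R : R).
Proof.
move=> m2 lt.
have m2R : 2 <= m%:R :> R by rewrite ler_nat.
have K0 : 0 < K by rewrite /K; lra.
have ln_le : ln K <= 2 * ln (m%:R : R).
  rewrite mulr2n mulrDl mul1r -lnM ?posrE; try lra.
  by rewrite ler_ln ?posrE /K; nra.
have y0 : 0 <= 1 - (K + K)^-1.
  by rewrite subr_ge0 invf_le1 /K; lra.
have le : (1 - (K + K)^-1) ^+ a <= expR (- (a%:R * (K + K)^-1)).
  rewrite -mulrN expRM_natl; apply: lerXn2r; rewrite ?nnegrE ?expR_ge0 //.
  exact: expR_ge1Dx.
have small : K^-1 ^+ 6 = expR (- (6%:R * ln K)).
  by rewrite -mulrN expRM_natl expRN lnK.
move: (lt_le_trans lt le); rewrite small ltr_expR ltrN2 => lt'.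
have KK0 : 0 < K + K by lra.
rewrite ltr_pdivrMr // in lt'.
apply: lt_le_trans lt' _.
have lnm : 0 <= ln (m%:R : R) by rewrite ln_ge0; lra.
by rewrite /K; nra.
Qed.

End Logarithm.

(** Bounds [n + m * T.+1] by way of [T.+1 <= 48 m ln m + 2] and [ln m <= m]; being at least [m] and
    [n] too, it bounds the turns of every loop. *)
Definition walk_bound (m n : nat) : nat := (n + m * (48 * m * m + 2))%N.

(** The outer indeterminate stands for [n], the inner one for [m]. *)
Definition walk_bound_poly : {poly {poly nat}} :=
  'X + ('X * (48%N%:P * 'X * 'X + 2%N%:P))%:P.

Lemma horner2_walk_bound (m n : nat) :
  walk_bound_poly.[n%:P].[m] = walk_bound m n.
Proof. by rewrite /walk_bound_poly !(hornerD, hornerM, hornerX, hornerC). Qed.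

Theorem theorem3p1 (R : realType) :
  exists C : R, 0 < C /\
    (forall (m n : nat) (A : 'M[R]_(m, n)) (b : 'cV[R]_m) (x v : 'cV[R]_n),
       (2 <= m)%N -> \rank A = m -> in_polyhedron A b x -> vertex A b v ->
       exists (k : nat) (w : nat -> 'cV[R]_n),
         circuit_walk A b x v k w /\
         k%:R <= n%:R + C * m%:R ^+ 2 * ln m%:R) /\
    (exists (p : prog) (q : {poly {poly nat}}),
       forall (m n : nat) (A : 'M[R]_(m, n)) (b : 'cV[R]_m) (x v : 'cV[R]_n),
         (2 <= m)%N -> \rank A = m -> in_polyhedron A b x -> vertex A b v ->
         exists (t : nat) (s : store R),
           [/\ exec p (input_store A b x v) t s,
               (t <= q.[n%:P].[m])%N,
               circuit_walk A b x v (output_length s) (output_walk n s)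
             & (output_length s)%:R <= n%:R + C * m%:R ^+ 2 * ln m%:R]).
Proof.
(* The 48 comes from [geometric_decay]; [2 / ln 2] absorbs the additive [2 * m], as
   [ln m >= ln 2]. *)
pose C : R := 48 + 2 / ln 2.
have ln2 : 0 < ln (2 : R) by rewrite ln_gt0 // ltr1n.
have C0 : 0 < C by rewrite addr_gt0 // divr_gt0.
have main (m n : nat) (A : 'M[R]_(m, n)) (b : 'cV[R]_m) (x v : 'cV[R]_n) :
    (2 <= m)%N -> in_polyhedron A b x -> vertex A b v ->
    exists (t : nat) (s : store R),
      [/\ exec CircuitWalk (input_store A b x v) t s,
          (t <= (loop_cost walk_bound_poly CircuitWalk).[n%:P].[m])%N,
          circuit_walk A b x v (output_length s) (output_walk n s)
        & (output_length s)%:R <= n%:R + C * m%:R ^+ 2 * ln m%:R].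
  move=> m2 xP vV.
  have m2R : 2 <= m%:R :> R by rewrite ler_nat.
  have m0 : 0 < m%:R :> R by lra.
  pose l : R := 48 * m%:R * ln m%:R.
  have lnm : ln 2 <= ln (m%:R : R) by rewrite ler_ln ?posrE.
  have l0 : 0 <= l by rewrite !mulr_ge0 ?ler0n //; lra.
  (* Truncation rounds down, so the successor is needed for [a < l] to imply [a < T]. *)
  pose T := (Num.truncn l).+1.
  have Tl : T%:R <= l + 1 by rewrite /T -natr1 lerD2r truncn_le.
  have decay a : (m%:R + m%:R)^-1 ^+ 6 <
      (1 - ((m%:R + m%:R) + (m%:R + m%:R))^-1 : R) ^+ a -> (a < T)%N.
    move=> /(geometric_decay m2) al; rewrite -(ltr_nat R).
    exact: lt_trans al (truncnS_gt l).
  have TL : (m * T.+1 <= m * (48 * m * m + 2))%N.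
    rewrite leq_mul2l; apply/orP; right.
    rewrite -(ler_nat R) -natr1 natrD !natrM.
    have := ln_sublinear m0; rewrite /l in Tl; nra.
  have wb : (n + m * T.+1 <= walk_bound m n)%N by rewrite leq_add2l.
  have nL : (n <= walk_bound m n)%N by rewrite leq_addr.
  have mL : (m <= walk_bound m n)%N.
    by apply: leq_trans wb; rewrite mulnS addnCA leq_addr.
  have [t [s [ex le [walk len]]]] := wp_circuit_walk m2 xP vV mL nL wb decay.
  exists t, s; split=> //; first by rewrite horner2_loop_cost horner2_walk_bound.
  apply: (le_trans (y := (n + m * T.+1)%:R)); first by rewrite ler_nat.
  rewrite natrD lerD2l natrM -natr1.
  have : m%:R * (T%:R + 1) <= m%:R * (l + 2) by rewrite ler_pM2l //; lra.
  move=> /le_trans; apply.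
  have mm : 2 * m%:R <= m%:R ^+ 2 :> R by rewrite expr2 ler_pM2r.
  have le1 : 1 <= ln m%:R / ln 2 :> R by rewrite ler_pdivlMr // mul1r.
  have : m%:R ^+ 2 * 1 <= m%:R ^+ 2 * (ln m%:R / ln 2) :> R.
    by rewrite ler_wpM2l // sqr_ge0.
  have : 0 <= m%:R ^+ 2 * (ln m%:R / ln 2) :> R.
    by rewrite mulr_ge0 ?sqr_ge0 //; lra.
  have -> : C * m%:R ^+ 2 * ln m%:R =
      m%:R * l + 2 * (m%:R ^+ 2 * (ln m%:R / ln 2)) :> R.
    by rewrite /C /l; field; rewrite gt_eqF.
  by move: mm; clear; move=> *; lra.
exists C; split=> //; split.
  move=> m n A b x v m2 _ xP vV.
  have [t [s [_ _ walk len]]] := main m n A b x v m2 xP vV.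
  by exists (output_length s), (output_walk n s).
exists CircuitWalk, (loop_cost walk_bound_poly CircuitWalk).
by move=> m n A b x v m2 _ xP vV; apply: main.
Qed.
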